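(* Let $\mu_0=\int_0^1\theta\,dF(\theta)$. For $\mu\in[0,1]$ let $$U(\mu)=\int_0^{\tilde\theta(\mu)}t(\mu,\theta)(H-L)\,dF(\theta),\qquad \Pi(\mu)=\int_0^{\tilde\theta(\mu)}L\,dF(\theta)+\int_{\tilde\theta(\mu)}^{1}t(\mu,\theta)H\,dF(\theta),$$ with $t(\mu,\theta)$ and $\tilde\theta(\mu)$ as defined in the context, and let $$\mathrm{graph}(U,\Pi)=\{(\mu,U(\mu),\Pi(\mu)):\mu\in[0,1]\}\subseteq\mathbb{R}^3 .$$ Then the set of all implementable outcomes is $$\mathcal{E}=\{(x,y):(\mu_0,x,y)\in\mathrm{co}(\mathrm{graph}(U,\Pi))\},$$ where $\mathrm{co}$ denotes the convex hull.
   Context: Setting. Fix reals $H>L>0$ and $V=\{L,H\}$. A seller's type $\theta\in\Theta\subseteq[0,1]$ is drawn from a probability measure $F$ on $[0,1]$; conditional on $\theta$, the buyer's value $v\in V$ equals $H$ with probability $\theta$ and $L$ with probability $1-\theta$. A signal $\mathcal{I}=(S,\pi)$ is a set $S$ of realizations together with probability distributions $\pi(\cdot\mid v)$ on $S$, $v\in V$. A menu is a set of signals. Game induced by a menu $\mathcal{M}$: (1) nature draws $\theta\sim F$ and then $v$ according to $\theta$; (2) the seller privately observes $\theta$ and chooses a signal $\mathcal{I}=(S,\pi)\in\mathcal{M}$; (3) the seller observes a realization $s\sim\pi(\cdot\mid v)$ and posts a price $p\in\mathbb{R}$; (4) the buyer observes $v$ and $p$ and decides whether to buy. If trade occurs the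 buyer gets $v-p$ and the seller gets $p$; otherwise both get $0$. The solution concept is perfect Bayesian equilibrium. An outcome is a pair (buyer's ex ante expected payoff, seller's ex ante expected payoff). It is implementable if it arises in an equilibrium of the game induced by some menu. Definitions. The basic posterior belief $\mu\in[0,1]$ of a signal realization is the posterior probability of $v=H$ that it induces in a hypothetical uninformed seller with prior $\mu_0$. By Bayes' rule a seller of type $\theta$ observing the same realization has posterior probability of $v=H$ equal to $$t(\mu,\theta)=\frac{\theta\mu(1-\mu_0)}{\theta\mu(1-\mu_0)+(1-\theta)(1-\mu)\mu_0}.$$ With posterior $t$ the seller sets price $H$ if $t>L/H$ and price $L$ if $t<L/H$. The threshold type $\tilde\theta(\mu)$ is uniquely defined by $t(\mu,\tilde\theta(\mu))=L/H$ for $\mu\in(0,1)$, with $\tilde\theta(0)=1$ and $\tilde\theta(1)=0$; after a realization with basic posterior $\mu$, types $\theta>\tilde\theta(\mu)$ set price $H$ and types $\theta<\tilde\theta(\mu)$ set price $L$.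
   Formalization: U and Π are integrated against the law of θ given basic posterior μ, not the prior F (with F the claim is false); a threshold type that is an atom of F may split between prices L and H, all splits entering the graph; and 0<μ0<1 is assumed. *)

(* Defs.v *)
(* MathComp / MathComp-Analysis; reals are an abstract R : realType. *)
From HB Require Import structures.
From mathcomp Require Import all_boot all_order all_algebra.
From mathcomp Require Import all_classical all_reals all_analysis.
From mathcomp Require Import ring lra.

Set Implicit Arguments.
Unset Strict Implicit.
Unset Printing Implicit Defensive.

Import Order.TTheory GRing.Theory Num.Theory.
Import numFieldNormedType.Exports.

Local Open Scope classical_set_scope.
Local Open Scope ring_scope.

(* A value v in {L, H} is encoded by a boolean, true standing for H. *)
Definition val_of (R : realType) (L H : R) (v : bool) : R := if v then H else L.

Record signal (R : realType) := Signal {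
  sig_disp : measure_display ;
  sig_space : measurableType sig_disp ;
  sig_law : bool -> probability sig_space R }.

Arguments sig_space {R}.
Arguments sig_law {R}.

(* A set of signals; the type of all signals lives in too large a universe to be
   an argument of [set]. *)
Definition menu (R : realType) := signal R -> Prop.

(* Seller: [choice theta w] is the signal chosen by type theta when the outcome
   of the seller's private randomization is w, drawn uniformly from [0, 1]
   (mixed strategy over the menu; a pure choice ignores w), and
   [price theta I s] is the (possibly degenerate) law of the price posted by
   type theta after the realization s of I.
   Buyer: [buy v p] is the probability of buying; the buyer sees only v and p.
   [belief theta I s] is the probability that type theta assigns to v = H after
   the realization s of I.  The beliefs of the buyer about theta, I and s do not
   enter his payoff and are omitted. *)
Record assessment (R : realType) := Assessment {
  choice : R -> R -> signal R ;
  price : R -> forall I : signal R, R.-pker sig_space I ~> measurableTypeR R ;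
  buy : bool -> R -> R ;
  belief : R -> forall I : signal R, sig_space I -> R }.

Section game.
Variables (R : realType) (L H : R).
Variables (Theta : set (measurableTypeR R)) (F : probability (measurableTypeR R) R).
Variables (M : menu R) (a : assessment R).

Definition seller_gain (v : bool) (p : R) : R := buy a v p * p.

Definition buyer_gain (v : bool) (p : R) : R :=
  buy a v p * (val_of L H v - p).

Definition interim (g : bool -> R -> R) (theta : R) (I : signal R) : R :=
  let given v := \int[sig_law I v]_(s in setT)
                   \int[price a theta I s]_(p in setT) g v p in
  theta * given true + (1 - theta) * given false.

Definition revenue (q p : R) : R :=
  q * seller_gain true p + (1 - q) * seller_gain false p.

Definition buyer_rational : Prop :=
  [/\ forall v, measurable_fun setT (buy a v : measurableTypeR R -> R),
      forall v p, 0 <= buy a v p <= 1 &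
      forall v p (b : R), 0 <= b <= 1 ->
        b * (val_of L H v - p) <= buyer_gain v p].

(* Bayes' rule on a general space of realizations: [belief theta I] is a version
   of the conditional probability of v = H given s when the prior is theta.  It
   is imposed for every signal of the menu, also those theta does not choose:
   the seller's own deviation reveals nothing about v. *)
Definition bayes_consistent : Prop :=
  forall theta (I : signal R), Theta theta -> M I ->
  [/\ measurable_fun setT (belief a theta (I:=I)),
      forall s : sig_space I, 0 <= belief a theta s <= 1 &
      forall A : set (sig_space I), measurable A ->
        theta * fine (sig_law I true A) =
          theta * \int[sig_law I true]_(s in A) belief a theta s
          + (1 - theta) * \int[sig_law I false]_(s in A) belief a theta s].

(* After every realization, on or off path, almost every posted price is optimal
   among all real prices. *)
Definition pricing_rational : Prop :=
  forall theta (I : signal R) (s : sig_space I), Theta theta -> M I ->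
    {ae price a theta I s, forall p : measurableTypeR R,
      forall p' : R, revenue (belief a theta s) p' <= revenue (belief a theta s) p}.

(* The pricing and purchase conditions force posted prices into [L, H] almost
   surely, so the integrals in [interim] are those of bounded functions. *)
Definition choice_rational : Prop :=
  forall theta w, Theta theta -> 0 <= w <= 1 ->
    M (choice a theta w) /\
    forall I, M I -> interim seller_gain theta I
                     <= interim seller_gain theta (choice a theta w).

(* Admissibility of the signal choice: ex ante payoffs are expectations of
   measurable functions of (theta, w). *)
Definition choice_measurable : Prop :=
  forall g, g = seller_gain \/ g = buyer_gain ->
    measurable_fun (Theta `*` (`[0, 1] : set (measurableTypeR R)))
      (fun x : measurableTypeR R * measurableTypeR R =>
         interim g x.1 (choice a x.1 x.2)).

Definition equilibrium : Prop :=
  [/\ buyer_rational, bayes_consistent, pricing_rational, choice_rational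
    & choice_measurable].

Definition ex_ante (g : bool -> R -> R) : R :=
  \int[F]_(theta in Theta)
    \int[uniform_prob (@ltr01 R)]_(w in `[0, 1]) interim g theta (choice a theta w).

End game.

(* Pairs (buyer's payoff, seller's payoff). *)
Definition implementable (R : realType) (L H : R)
    (Theta : set (measurableTypeR R)) (F : probability (measurableTypeR R) R)
    : set (R * R) :=
  [set o | exists (M : menu R) (a : assessment R),
    equilibrium L H Theta M a /\
    o = (ex_ante Theta F a (buyer_gain L H a), ex_ante Theta F a (seller_gain a))].

Definition prior_mean (R : realType) (F : probability (measurableTypeR R) R) : R :=
  \int[F]_(theta in `[0, 1]) theta.

Definition convex_hull (R : realType) (V : lmodType R) (A : set V) : set V :=
  smallest (@convex_set R V) A.

Section payoff_curve.
Variables (R : realType) (L H : R) (F : probability (measurableTypeR R) R).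

Let mu0 := prior_mean F.

(* At (mu, theta) = (0, 1) and (1, 0) the formula reads 0 / 0, hence 0; type theta
   never observes such a realization, and [type_density] vanishes there. *)
Definition t (mu theta : R) : R :=
  theta * mu * (1 - mu0)
  / (theta * mu * (1 - mu0) + (1 - theta) * (1 - mu) * mu0).

Definition threshold (mu : R) : R :=
  if mu == 0 then 1 else if mu == 1 then 0
  else xget 0 [set theta | 0 <= theta <= 1 /\ t mu theta = L / H].

(* Density, with respect to F, of the law F(. | mu) of the seller's type given
   that the realization has basic posterior mu: v = H given mu has probability
   mu, and a type has density theta / mu0 given v = H and
   (1 - theta) / (1 - mu0) given v = L. *)
Definition type_density (mu theta : R) : R :=
  theta * mu / mu0 + (1 - theta) * (1 - mu) / (1 - mu0).

(* The integral of f over D against F(. | mu).  U(mu) and Pi(mu) are expected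
   payoffs given a realization with basic posterior mu, and then types are
   distributed according to F(. | mu), not F: type and realization are
   independent only conditionally on v.  The two laws agree at mu = mu0.  With
   the prior F instead, the convex hull would contain pairs (x, y) with
   x + y > E[v], for instance when L = 1, H = 2 and F is uniform on
   [2/5, 3/5]. *)
Definition integral_given (mu : R) (D : set (measurableTypeR R)) (f : R -> R) : R :=
  \int[F]_(theta in D) (f theta * type_density mu theta).

(* lam is the probability with which the indifferent type, threshold mu, posts
   the price L.  It matters only if F has an atom there (see [U_noatom] and
   [Pi_noatom]); then U and Pi are correspondences and the graph contains their
   values for all tie-breaking rules. *)
Definition U (lam mu : R) : R :=
  integral_given mu `[0, threshold mu[ (fun theta => t mu theta * (H - L))
  + lam * integral_given mu [set threshold mu] (fun theta => t mu theta * (H - L)).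

Definition Pi (lam mu : R) : R :=
  integral_given mu `[0, threshold mu[ (fun=> L)
  + integral_given mu `]threshold mu, 1] (fun theta => t mu theta * H)
  + (lam * integral_given mu [set threshold mu] (fun=> L)
     + (1 - lam) * integral_given mu [set threshold mu] (fun theta => t mu theta * H)).

Definition graph : set (R^o * R^o * R^o) :=
  [set z | exists mu lam, [/\ 0 <= mu <= 1, 0 <= lam <= 1 &
                             z = (mu, U lam mu, Pi lam mu)]].

Lemma thresholdP mu : 0 < L -> L < H -> 0 < mu0 < 1 -> 0 < mu < 1 ->
  forall theta, 0 <= theta <= 1 -> (t mu theta = L / H <-> theta = threshold mu).
Proof.
move=> L0 LH /andP[m0 m1] /andP[u0 u1].
have H0 : 0 < H by exact: lt_trans LH.
have HL : 0 < H - L by rewrite subr_gt0.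
have a0 : 0 < mu * (1 - mu0) by rewrite mulr_gt0// subr_gt0.
have b0 : 0 < (1 - mu) * mu0 by rewrite mulr_gt0// subr_gt0.
set a := mu * (1 - mu0) in a0; set b := (1 - mu) * mu0 in b0.
pose d := L * b + (H - L) * a.
have d0 : 0 < d by rewrite addr_gt0// mulr_gt0.
have tE theta : 0 <= theta <= 1 -> (t mu theta = L / H <-> theta = L * b / d).
  move=> /andP[th0 th1].
  have e0 : 0 < theta * a + (1 - theta) * b.
    have [->|thn1] := eqVneq theta 1; first by rewrite mul1r subrr mul0r addr0.
    apply: ltr_wpDl; first by rewrite mulr_ge0// ltW.
    by rewrite mulr_gt0// subr_gt0 lt_neqAle thn1.
  have -> : t mu theta = theta * a / (theta * a + (1 - theta) * b).
    by rewrite /t -!mulrA.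
  split=> e.
  - apply: (mulIf (lt0r_neq0 d0)); rewrite divfK ?lt0r_neq0//.
    move/eqP: e; rewrite eqr_div ?lt0r_neq0// /d => /eqP e; lra.
  - apply/eqP; rewrite eqr_div ?lt0r_neq0//; apply/eqP.
    have : theta * d = L * b by rewrite e divfK ?lt0r_neq0.
    rewrite /d => {}e; lra.
have c01 : 0 <= L * b / d <= 1.
  have Lb0 : 0 < L * b by rewrite mulr_gt0.
  have HLa0 : 0 < (H - L) * a by rewrite mulr_gt0.
  by rewrite divr_ge0 ?(ltW Lb0) ?(ltW d0)//= ler_pdivrMr// mul1r lerDl ltW.
suff -> : threshold mu = L * b / d by exact: tE.
  rewrite /threshold gt_eqF// lt_eqF//; case: xgetP => [x _ [x01 /(tE _ x01)//]|].
  by move=> /(_ (L * b / d)) []; split => //; exact/tE.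
Qed.

Lemma integral_given_noatom mu theta (f : R -> R) :
  F [set theta] = 0%E -> integral_given mu [set theta] f = 0.
Proof.
move=> F0; rewrite /integral_given /Rintegral null_set_integral//.
exact: measurable_fun_set1.
Qed.

Lemma U_noatom lam mu : F [set threshold mu] = 0%E ->
  U lam mu = integral_given mu `[0, threshold mu[ (fun theta => t mu theta * (H - L)).
Proof. by move=> F0; rewrite /U integral_given_noatom// mulr0 addr0. Qed.

Lemma Pi_noatom lam mu : F [set threshold mu] = 0%E ->
  Pi lam mu = integral_given mu `[0, threshold mu[ (fun=> L)
    + integral_given mu `]threshold mu, 1] (fun theta => t mu theta * H).
Proof. by move=> F0; rewrite /Pi !integral_given_noatom// !mulr0 !addr0. Qed.

Definition hull_section : set (R * R) :=
  [set o | convex_hull graph (mu0, o.1, o.2)].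

End payoff_curve.

(* Main.v *)
(* Seller.  Given the signal he has chosen, the interim profit of a type theta is
   the maximum of the profits of the pricing rules, and each rule is affine in
   theta: it depends only on the probabilities i and j of the price L given
   v = H and v = L.  Hence the equilibrium profit of the types extends to a
   convex function V on [0, 1] with V(0) = L, V(1) = H, V >= L and
   V >= H theta, and the surplus left to the buyer by type theta is
   theta (H - V(theta) - (1 - theta) p) for a subgradient p of V at theta.

   From V to one signal.  Let p be uniform on [0, H], let c(p) maximize
   p theta - V(theta) over [0, 1] and let W(p) be the maximum.  Since c is a
   subgradient of W, the integral of c over [p, p'] is W(p') - W(p).  The
   realization p with likelihoods proportional to (1 - c(p)) / (H - L) given H
   and c(p) / L given L has threshold type c(p); integrating in p reproduces V,
   and with the right tie-breaking at c(p) = theta also the buyer's surplus.  So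
   the outcome is the barycenter of a law carried by the graph.

   Barycenters.  The barycenter of a law carried by a convex set of R^n belongs
   to that set, closed or not.  One coordinate is fixed at a time: pairs of
   points on opposite sides of a hyperplane through the barycenter are replaced
   by the point where their segment crosses it.

   Conversely a finite convex combination of points of the graph is the outcome
   of the menu made of one signal with finitely many realizations. *)
Require Import Defs.
From HB Require Import structures.
From mathcomp Require Import all_boot all_order all_algebra.
From mathcomp Require Import all_classical all_reals all_analysis.
From mathcomp Require Import measurable_realfun ring lra.
Import Order.TTheory GRing.Theory Num.Theory.
Import numFieldNormedType.Exports.
Local Open Scope classical_set_scope.
Local Open Scope ring_scope.

Set Implicit Arguments.
Unset Strict Implicit.
Unset Printing Implicit Defensive.

(** * Expectations of bounded measurable functions *)

Section bounded_measurable.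
Context d (T : measurableType d) (R : realType).
Implicit Types f g : T -> R.

(** Closed under the operations below and integrable against every probability, so that linearity
    and Fubini for real-valued integrals carry no separate integrability hypothesis. *)
Definition bmeas f := measurable_fun setT f /\ exists B, forall x, `|f x| <= B.

Lemma bmeas_cst c : bmeas (fun=> c).
Proof. by split; [exact: measurable_cst|exists `|c|]. Qed.

Lemma bmeasD f g : bmeas f -> bmeas g -> bmeas (fun x => f x + g x).
Proof.
move=> [mf [B fB]] [mg [C gC]]; split; first exact: measurable_funD.
by exists (B + C) => x; rewrite (le_trans (ler_normD _ _))// lerD.
Qed.

Lemma bmeasM f g : bmeas f -> bmeas g -> bmeas (fun x => f x * g x).
Proof.
move=> [mf [B fB]] [mg [C gC]]; split; first exact: measurable_funM.
by exists (B * C) => x; rewrite normrM ler_pM.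
Qed.

Lemma bmeasN f : bmeas f -> bmeas (fun x => - f x).
Proof.
move=> [mf [B fB]]; split; first exact: measurableT_comp.
by exists B => x; rewrite normrN.
Qed.

Lemma bmeasB f g : bmeas f -> bmeas g -> bmeas (fun x => f x - g x).
Proof. by move=> bf /bmeasN; exact: bmeasD. Qed.

Lemma bmeas_if (b : T -> bool) f g : measurable_fun setT b ->
  bmeas f -> bmeas g -> bmeas (fun x => if b x then f x else g x).
Proof.
move=> mb [mf [B fB]] [mg [C gC]]; split; first exact: measurable_fun_ifT.
exists (Num.max B C) => x; case: ifP => _; rewrite le_max ?fB//.
by rewrite gC orbT.
Qed.

Lemma bmeas_bool (b : T -> bool) : measurable_fun setT b ->
  bmeas (fun x => (b x)%:R).
Proof.
move=> mb; rewrite (_ : (fun _ => _) = fun x => if b x then 1 else 0).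
  exact: (bmeas_if mb (bmeas_cst 1) (bmeas_cst 0)).
by apply/funext => x; case: (b x).
Qed.

Lemma bmeas_sum I (r : seq I) (F : I -> T -> R) : (forall i, bmeas (F i)) ->
  bmeas (fun x => \sum_(i <- r) F i x).
Proof.
move=> bF; elim: r => [|i r IH].
  by under eq_fun do rewrite big_nil; exact: bmeas_cst.
by under eq_fun do rewrite big_cons; exact: bmeasD.
Qed.

Lemma bmeas_le f (B : R) : measurable_fun setT f -> (forall x, 0 <= f x <= B) -> bmeas f.
Proof.
move=> mf f0B; split => //; exists B => x.
by have /andP[f0 fB] := f0B x; rewrite ger0_norm.
Qed.

End bounded_measurable.

Lemma bmeas_comp d d' (T : measurableType d) (T' : measurableType d')
    (R : realType) (f : T -> R) (h : T' -> T) :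
  measurable_fun setT h -> bmeas f -> bmeas (fun x => f (h x)).
Proof.
move=> mh [mf [B fB]]; split; first exact: measurableT_comp.
by exists B => x.
Qed.

Section expectation.
Context d (T : measurableType d) (R : realType) (P : probability T R).
Implicit Types f g : T -> R.

Let PT : (P : {measure set T -> \bar R}) setT = 1%E := probability_setT P.

Lemma bmeas_integrable f : bmeas f -> P.-integrable setT (EFin \o f).
Proof.
move=> [mf [B fB]]; apply: measurable_bounded_integrable => //.
  by rewrite PT ltry.
exists B; split; first by rewrite num_real.
by move=> M BM x _ /=; rewrite (le_trans (fB x))// ltW.
Qed.

Lemma expect_cst c : \int[P]_x c = c.
Proof. by rewrite Rintegral_cst// PT mulr1. Qed.

Lemma expectD f g : bmeas f -> bmeas g ->
  \int[P]_x (f x + g x) = \int[P]_x f x + \int[P]_x g x.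
Proof. by move=> bf bg; rewrite RintegralD//; exact: bmeas_integrable. Qed.

Lemma expectB f g : bmeas f -> bmeas g ->
  \int[P]_x (f x - g x) = \int[P]_x f x - \int[P]_x g x.
Proof. by move=> bf bg; rewrite RintegralB//; exact: bmeas_integrable. Qed.

Lemma expectZl c f : bmeas f -> \int[P]_x (c * f x) = c * \int[P]_x f x.
Proof. by move=> bf; rewrite RintegralZl//; exact: bmeas_integrable. Qed.

Lemma expectZr c f : bmeas f -> \int[P]_x (f x * c) = (\int[P]_x f x) * c.
Proof. by move=> bf; rewrite RintegralZr//; exact: bmeas_integrable. Qed.

Lemma expect_sum I (r : seq I) (F : I -> T -> R) : (forall i, bmeas (F i)) ->
  \int[P]_x (\sum_(i <- r) F i x) = \sum_(i <- r) \int[P]_x F i x.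
Proof.
move=> bF; elim: r => [|i r IH].
  by rewrite big_nil; under eq_Rintegral do rewrite big_nil; rewrite expect_cst.
rewrite big_cons -IH -expectD//; last exact: bmeas_sum.
by apply: eq_Rintegral => x _; rewrite big_cons.
Qed.

Lemma le_expect f g : bmeas f -> bmeas g -> (forall x, f x <= g x) ->
  \int[P]_x f x <= \int[P]_x g x.
Proof. by move=> bf bg fg; apply: le_Rintegral => //; exact: bmeas_integrable. Qed.

Lemma eq_Rintegral_ae f g : measurable_fun setT f -> measurable_fun setT g ->
  {ae P, forall x, f x = g x} -> \int[P]_x f x = \int[P]_x g x.
Proof.
move=> mf mg fg; rewrite /Rintegral; congr fine; apply: ae_eq_integral => //.
- exact/measurable_EFinP.
- exact/measurable_EFinP.
- by apply: filterS fg => x /= -> _.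
Qed.

Lemma eq_expect_ae f g : bmeas f -> bmeas g -> {ae P, forall x, f x = g x} ->
  \int[P]_x f x = \int[P]_x g x.
Proof. by move=> [mf _] [mg _]; exact: eq_Rintegral_ae. Qed.

Lemma ae_sub (A B : T -> Prop) : {ae P, forall x, A x} ->
  (forall x, A x -> B x) -> {ae P, forall x, B x}.
Proof. by move=> PA AB; apply: filterS PA. Qed.

Lemma le_expect_ae f g : bmeas f -> bmeas g -> {ae P, forall x, f x <= g x} ->
  \int[P]_x f x <= \int[P]_x g x.
Proof.
move=> bf bg fg.
have mm : measurable_fun setT (fun x => f x <= g x).
  by apply: measurable_fun_ler; [case: bf|case: bg].
(* [h] is the pointwise minimum: below [g] everywhere and equal to [f] almost everywhere. *)
pose h x := if f x <= g x then f x else g x.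
have bh : bmeas h by exact: bmeas_if.
rewrite (_ : \int[P]_x f x = \int[P]_x h x).
  by apply: le_expect => // x; rewrite /h; case: ifP.
apply: eq_expect_ae => //; apply: filterS fg => x /=; by rewrite /h => ->.
Qed.

Lemma expect_ge0 f : (forall x, 0 <= f x) -> 0 <= \int[P]_x f x.
Proof. by move=> f0; exact: Rintegral_ge0. Qed.

Lemma expect_itv f (a b : R) : bmeas f -> (forall x, a <= f x <= b) ->
  a <= \int[P]_x f x <= b.
Proof.
move=> bf fab; have ba := bmeas_cst T a; have bb := bmeas_cst T b.
have := le_expect ba bf (fun x => proj1 (andP (fab x))).
have := le_expect bf bb (fun x => proj2 (andP (fab x))).
by rewrite !expect_cst => -> ->.
Qed.

Lemma expect_eq0 f : bmeas f -> (forall x, 0 <= f x) -> \int[P]_x f x = 0 ->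
  {ae P, forall x, f x = 0}.
Proof.
move=> bf f0 If.
have /integrable_fin_num fin : P.-integrable setT (EFin \o f) by exact: bmeas_integrable.
have I0 : (\int[P]_x (EFin \o f) x = 0)%E.
  by rewrite -(fineK (fin measurableT)) -[fine _]/(\int[P]_x f x) If.
have [mf _] := bf.
have mf' : measurable_fun setT (EFin \o f) by exact/measurable_EFinP.
have : (\int[P]_x `|(EFin \o f) x| = 0)%E.
  by rewrite -[RHS]I0; apply: eq_integral => x _; rewrite gee0_abs// lee_fin.
move=> /(ae_eq_integral_abs P measurableT mf').
by apply: filterS => x /= /(_ I) [].
Qed.

Lemma expect_indic A : measurable A -> \int[P]_x (\1_A x) = fine (P A).
Proof.
by move=> mA; rewrite /Rintegral integral_indic// setIT.
Qed.

End expectation.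

(** * Fubini's theorem for bounded functions *)

Section fubini_bounded.
Context d1 d2 (T1 : measurableType d1) (T2 : measurableType d2) (R : realType).
Variables (P : probability T1 R) (Q : probability T2 R).
Implicit Types h : T1 * T2 -> R.

Let EFin_section1 h x : bmeas h ->
  (\int[Q]_y (h (x, y))%:E = (\int[Q]_y h (x, y))%:E)%E.
Proof.
move=> bh; rewrite /Rintegral fineK//; apply: integrable_fin_num => //.
apply: (@bmeas_integrable _ _ _ Q (fun y => h (x, y))).
by apply: (@bmeas_comp _ _ _ _ _ h (pair x)) => //; exact: measurable_pair1.
Qed.

Let EFin_section2 h y : bmeas h ->
  (\int[P]_x (h (x, y))%:E = (\int[P]_x h (x, y))%:E)%E.
Proof.
move=> bh; rewrite /Rintegral fineK//; apply: integrable_fin_num => //.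
apply: (@bmeas_integrable _ _ _ P (fun x => h (x, y))).
by apply: (@bmeas_comp _ _ _ _ _ h (pair ^~ y)) => //; exact: measurable_pair2.
Qed.

Lemma bmeas_pair1 h x : bmeas h -> bmeas (fun y => h (x, y)).
Proof. by apply: bmeas_comp; exact: measurable_pair1. Qed.

Lemma bmeas_pair2 h y : bmeas h -> bmeas (fun x => h (x, y)).
Proof. by apply: (@bmeas_comp _ _ _ _ _ h (pair ^~ y)); exact: measurable_pair2. Qed.

Lemma bmeas_expect2 h : bmeas h -> bmeas (fun x => \int[Q]_y h (x, y)).
Proof.
move=> bh; split.
  have := measurable_fubini_F (bmeas_integrable (P \x Q)%E bh).
  rewrite /fubini_F/=; under eq_fun do rewrite EFin_section1//.
  by move=> mF; exact/measurable_EFinP.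
have [_ [B hB]] := bh; exists B => x.
rewrite ler_norml; apply: expect_itv; first exact: bmeas_pair1.
by move=> y; rewrite -ler_norml.
Qed.

Lemma bmeas_expect1 h : bmeas h -> bmeas (fun y => \int[P]_x h (x, y)).
Proof.
move=> bh; split.
  have := measurable_fubini_G (bmeas_integrable (P \x Q)%E bh).
  rewrite /fubini_G/=; under eq_fun do rewrite EFin_section2//.
  by move=> mG; exact/measurable_EFinP.
have [_ [B hB]] := bh; exists B => y.
rewrite ler_norml; apply: expect_itv; first exact: bmeas_pair2.
by move=> x; rewrite -ler_norml.
Qed.

Lemma expect_prod1 h : bmeas h ->
  \int[(P \x Q)%E]_z h z = \int[P]_x \int[Q]_y h (x, y).
Proof.
move=> bh; rewrite {1 2}/Rintegral.
rewrite -(integral12_prod_meas1 (bmeas_integrable (P \x Q)%E bh)) /fubini_F/=.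
by congr fine; apply: eq_integral => x _; rewrite EFin_section1.
Qed.

Lemma expect_swap h : bmeas h ->
  \int[P]_x \int[Q]_y h (x, y) = \int[Q]_y \int[P]_x h (x, y).
Proof.
move=> bh; rewrite -expect_prod1// {1 2}/Rintegral.
rewrite -(integral21_prod_meas1 (bmeas_integrable (P \x Q)%E bh)) /fubini_G/=.
by congr fine; apply: eq_integral => x _; rewrite EFin_section2.
Qed.

End fubini_bounded.

Lemma measurable_fun_div d (T : measurableType d) (R : realType) (f g : T -> R) :
  measurable_fun setT f -> measurable_fun setT g ->
  measurable_fun setT (fun x => f x / g x).
Proof.
move=> mf mg; apply: measurable_funM => //.
(* The inverse is a signed real power of the absolute value; at a zero of [g] both are 0. *)
rewrite (_ : (fun _ => _) =
    fun x => if 0 <= g x then `|g x| `^ (-1) else - `|g x| `^ (-1)).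
  have mn : measurable_fun setT (fun x => `|g x| `^ (-1)).
    by apply: (measurableT_comp (measurable_powR (-1))); exact: measurableT_comp.
  apply: measurable_fun_ifT => //; first exact: measurable_fun_ler.
  exact: measurableT_comp.
apply/funext => x; rewrite powR_inv1//.
by case: ger0P => // _; rewrite invrN opprK.
Qed.

(** * Barycenters *)

Lemma expect_prodM d1 d2 (T1 : measurableType d1) (T2 : measurableType d2)
    (R : realType) (P : probability T1 R) (Q : probability T2 R)
    (a : T1 -> R) (b : T2 -> R) : bmeas a -> bmeas b ->
  \int[(P \x Q)%E]_z (a z.1 * b z.2) = (\int[P]_x a x) * (\int[Q]_y b y).
Proof.
move=> ba bb; have h1 := bmeas_comp (@measurable_fst _ _ T1 T2) ba.
have h2 := bmeas_comp (@measurable_snd _ _ T1 T2) bb.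
rewrite (expect_prod1 P Q (bmeasM h1 h2))/= -expectZr//.
by apply: eq_Rintegral => x _; rewrite expectZl.
Qed.

Section barycenter.
Context (R : realType) (n : nat) (A : set ('I_n -> R)).
Hypothesis convA : forall a b s, 0 <= s <= 1 -> A a -> A b ->
  A (fun i => s * a i + (1 - s) * b i).

(* [p] is the mean of a law carried by the points of [A] that agree with [p] on
   the first [k] coordinates. *)
Definition mean_on (p : 'I_n -> R) (k : nat) :=
  exists d (T : measurableType d) (P : probability T R)
         (rho : T -> R) (f : 'I_n -> T -> R),
  [/\ [/\ bmeas rho, forall x, 0 <= rho x & \int[P]_x rho x = 1],
      forall i, bmeas (f i),
      forall i, \int[P]_x (rho x * f i x) = p i,
      forall x, 0 < rho x -> A (f ^~ x) &
      forall x, 0 < rho x -> forall i : 'I_n, (i < k)%N -> f i x = p i].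

Section step.
Context d (T : measurableType d) (P : probability T R) (rho u : T -> R).
Hypotheses (brho : bmeas rho) (rho0 : forall x, 0 <= rho x) (bu : bmeas u).
Hypotheses (rho1 : \int[P]_x rho x = 1) (Eu : \int[P]_x (rho x * u x) = 0).

Let z x : R := (u x == 0)%:R.
Let pos x : R := (0 < u x)%R%:R.
Let neg x : R := (u x < 0)%R%:R.
Let up x : R := if 0 < u x then u x else 0.
Let um x : R := if u x < 0 then - u x else 0.
Let s := \int[P]_x (rho x * up x).

Let mu_ : measurable_fun setT u. Proof. by case: bu. Qed.
Let mp : measurable_fun setT (fun x => 0 < u x).
Proof. exact: measurable_fun_ltr. Qed.
Let mn : measurable_fun setT (fun x => u x < 0).
Proof. exact: measurable_fun_ltr. Qed.
Let mz : measurable_fun setT (fun x => u x == 0).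
Proof. exact: measurable_fun_eqr. Qed.
Let bz : bmeas z. Proof. exact: bmeas_bool. Qed.
Let bpos : bmeas pos. Proof. exact: bmeas_bool. Qed.
Let bneg : bmeas neg. Proof. exact: bmeas_bool. Qed.
Let bup : bmeas up. Proof. by apply: bmeas_if => //; exact: bmeas_cst. Qed.
Let bum : bmeas um.
Proof. by apply: bmeas_if => //; [exact: bmeasN|exact: bmeas_cst]. Qed.

(** [u] has mean zero under the density [rho], so its positive and negative parts have the same mean
    [s]. *)
Let Eum : \int[P]_x (rho x * um x) = s.
Proof.
apply/eqP; rewrite eq_sym -subr_eq0 /s -expectB; [|exact: bmeasM|exact: bmeasM].
apply/eqP; rewrite -Eu; apply: eq_Rintegral => x _; rewrite /up /um.
by case: (ltrgt0P (u x)) => [| |->]; rewrite ?mulr0 ?subr0 ?sub0r ?mulrN ?opprK.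
Qed.

(** Density with respect to [P \x P]. Points with [u = 0] keep their mass, paired with an idle
    independent second coordinate; a pair with [u w.1 > 0 > u w.2] gets weight proportional to
    [up w.1 + um w.2], the denominator in [crossing_coef]. *)
Definition crossing_weight (w : T * T) : R :=
  rho w.1 * rho w.2 * (z w.1 + s^-1 * ((up w.1 + um w.2) * (pos w.1 * neg w.2))).

Definition crossing_coef (w : T * T) : R :=
  if u w.1 == 0 then 1 else um w.2 / (up w.1 + um w.2).

Definition crossing (g : T -> R) (w : T * T) : R :=
  crossing_coef w * g w.1 + (1 - crossing_coef w) * g w.2.

Lemma up_ge0 x : 0 <= up x. Proof. by rewrite /up; case: ifP => // /ltW. Qed.
Lemma um_ge0 x : 0 <= um x.
Proof. by rewrite /um; case: ifP => // /ltW; rewrite oppr_ge0. Qed.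

Lemma crossing_coef01 w : 0 <= crossing_coef w <= 1.
Proof.
rewrite /crossing_coef; case: ifP => _; first by rewrite ler01 lexx.
have := um_ge0 w.2; have := up_ge0 w.1; set a := up _; set b := um _ => a0 b0.
rewrite divr_ge0 ?addr_ge0//=.
have [->|ab] := eqVneq (a + b) 0; first by rewrite invr0 mulr0.
by rewrite ler_pdivrMr ?mul1r ?lerDr// lt_neqAle eq_sym ab addr_ge0.
Qed.

Let f1 (g : T -> R) : bmeas g -> bmeas (fun w : T * T => g w.1).
Proof. by apply: bmeas_comp; exact: measurable_fst. Qed.
Let f2 (g : T -> R) : bmeas g -> bmeas (fun w : T * T => g w.2).
Proof. by apply: bmeas_comp; exact: measurable_snd. Qed.

Lemma bmeas_crossing g : bmeas g -> bmeas (crossing g).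
Proof.
move=> bg; have bc : bmeas crossing_coef.
  apply: (@bmeas_le _ _ _ _ 1); last exact: crossing_coef01.
  apply: measurable_fun_ifT => //.
    by apply: (measurableT_comp mz); exact: measurable_fst.
  apply: measurable_fun_div; first by case: (f2 bum).
  by case: (bmeasD (f1 bup) (f2 bum)).
apply: bmeasD; apply: bmeasM => //; [exact: f1| |exact: f2].
exact: bmeasB (bmeas_cst _ _) bc.
Qed.

Lemma bmeas_crossing_weight : bmeas crossing_weight.
Proof.
apply: bmeasM; first by apply: bmeasM; [exact: f1|exact: f2].
apply: bmeasD; first exact: f1.
apply: bmeasM; first exact: bmeas_cst.
apply: bmeasM; first by apply: bmeasD; [exact: f1|exact: f2].
by apply: bmeasM; [exact: f1|exact: f2].
Qed.

Lemma crossing_weight_ge0 w : 0 <= crossing_weight w.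
Proof.
have s0 : 0 <= s by apply: expect_ge0 => x; rewrite mulr_ge0// up_ge0.
by rewrite /crossing_weight !(mulr_ge0, addr_ge0) ?invr_ge0 ?up_ge0 ?um_ge0// /z ler0n.
Qed.

(** The denominator of [crossing_coef] cancels against the weight; what remains is a sum of products
    of a function of [w.1] and a function of [w.2], to which [expect_prodM] applies. *)
Lemma crossing_weightE g w : crossing_weight w * crossing g w =
  (rho w.1 * z w.1 * g w.1) * rho w.2
  + s^-1 * ((rho w.1 * pos w.1 * g w.1) * (rho w.2 * um w.2)
            + (rho w.1 * up w.1) * (rho w.2 * neg w.2 * g w.2)).
Proof.
rewrite /crossing_weight /crossing /crossing_coef /z /pos /neg /up /um.
case: (ltrgt0P (u w.1)) => [u1|u1|u1]; last first.
- by rewrite /=; ring.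
- by rewrite /=; ring.
case: (ltrgt0P (u w.2)) => [u2|u2|_] /=; [by ring| |by ring].
have u12 : u w.1 + - u w.2 != 0 by rewrite gt_eqF// addr_gt0// oppr_gt0.
have -> : 1 - - u w.2 / (u w.1 + - u w.2) = u w.1 / (u w.1 + - u w.2).
  by field.
transitivity (rho w.1 * rho w.2 * s^-1 * ((- u w.2 / (u w.1 + - u w.2) * g w.1
    + u w.1 / (u w.1 + - u w.2) * g w.2) * (u w.1 + - u w.2))); first by ring.
by rewrite mulrDl (mulrAC _ (g w.1)) (mulrAC _ (g w.2)) !divfK//; ring.
Qed.

Lemma expect_crossing g : bmeas g ->
  \int[(P \x P)%E]_w (crossing_weight w * crossing g w) = \int[P]_x (rho x * g x).
Proof.
move=> bg.
have b1 : bmeas (fun x => rho x * z x * g x) by do 2 apply: bmeasM => //.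
have b2 : bmeas (fun x => rho x * pos x * g x) by do 2 apply: bmeasM => //.
have b3 : bmeas (fun x => rho x * neg x * g x) by do 2 apply: bmeasM => //.
have b4 : bmeas (fun x => rho x * um x) by exact: bmeasM.
have b5 : bmeas (fun x => rho x * up x) by exact: bmeasM.
under eq_Rintegral do rewrite crossing_weightE.
have b6 := bmeasM (f1 b2) (f2 b4).
have b7 := bmeasM (f1 b5) (f2 b3).
rewrite expectD; [|exact: bmeasM (f1 b1) (f2 brho)|]; last first.
  by apply: bmeasM; [exact: bmeas_cst|exact: bmeasD].
rewrite expectZl; last exact: bmeasD.
rewrite expectD// (expect_prodM P P b1 brho) (expect_prodM P P b2 b4).
rewrite (expect_prodM P P b5 b3) rho1 mulr1 Eum -/s.
have [s0|s0] := eqVneq s 0; last first.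
  rewrite (mulrC _ s) -mulrDr mulrA mulVf// mul1r -!expectD//; last exact: bmeasD.
  apply: eq_Rintegral => x _; rewrite /z /pos /neg.
  by case: (ltrgt0P (u x)) => _ /=; ring.
(* When [s = 0], [rho] vanishes almost everywhere off [u = 0], so the term with [z] already carries
   the whole mean. *)
have ae1 := expect_eq0 b5 (fun x => mulr_ge0 (rho0 x) (up_ge0 x)) s0.
have ae2 := expect_eq0 b4 (fun x => mulr_ge0 (rho0 x) (um_ge0 x)) (etrans Eum s0).
rewrite s0 invr0 mul0r addr0; apply: eq_expect_ae => //; first exact: bmeasM.
apply: filterS2 ae1 ae2 => x; rewrite /up /um /z.
case: (ltrgt0P (u x)) => [u1 /eqP|u1 _ /eqP|_] /=; last by rewrite mulr1.
  by rewrite mulf_eq0 (gt_eqF u1) orbF => /eqP -> _; rewrite !mul0r.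
by rewrite mulf_eq0 oppr_eq0 (lt_eqF u1) orbF => /eqP ->; rewrite !mul0r.
Qed.

Lemma crossing_weight_gt0 w : 0 < crossing_weight w ->
  [/\ 0 < rho w.1, 0 < rho w.2 & crossing u w = 0].
Proof.
rewrite /crossing_weight lt0r => /andP[+ _].
rewrite !mulf_eq0 !negb_or => /andP[/andP[r1 r2] h].
rewrite !lt_neqAle !(eq_sym 0) r1 r2 !rho0; split=> //.
move: h; rewrite /crossing /crossing_coef /z /pos /neg /up /um.
case: (ltrgt0P (u w.1)) => [u1|u1|u1]; last 2 first.
- by rewrite /= !(mulr0n, mul0r, mulr0, addr0) eqxx.
- by move=> _; rewrite /= u1; ring.
case: (ltrgt0P (u w.2)) => [u2|u2|_] /=; try by rewrite !(mulr0n, mul0r, mulr0, addr0) eqxx.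
have u12 : u w.1 + - u w.2 != 0 by rewrite gt_eqF// addr_gt0// oppr_gt0.
by move=> _; field.
Qed.

End step.

(* If [x] and [y] lie on opposite sides of the hyperplane [f k = p k], replace
   the pair by the point where the segment from [f x] to [f y] crosses it; with
   the weights [crossing_weight] the mean is unchanged. *)
Lemma mean_onS p (k : 'I_n) : mean_on p k -> mean_on p k.+1.
Proof.
move=> [d [T [P [rho [f [[brho rho0 rho1] bf Ef Af fp]]]]]].
pose u x := f k x - p k.
have bu : bmeas u by exact: bmeasB (bf k) (bmeas_cst _ _).
have Eu : \int[P]_x (rho x * u x) = 0.
  rewrite /u; under eq_Rintegral do rewrite mulrBr.
  rewrite expectB ?expectZr ?Ef ?rho1 ?mul1r ?subrr//; first exact: bmeasM.
  exact: bmeasM (bmeas_cst _ _).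
exists _, (T * T)%type, (P \x P)%E, (crossing_weight P rho u), (fun i => crossing u (f i)).
split.
- split; [exact: bmeas_crossing_weight|exact: crossing_weight_ge0|].
  have := expect_crossing brho rho0 bu rho1 Eu (bmeas_cst T 1).
  under [in X in _ = X -> _]eq_Rintegral do rewrite mulr1.
  rewrite rho1 => <-; apply: eq_Rintegral => w _.
  by rewrite /crossing !mulr1 addrCA subrr addr0 mulr1.
- by move=> i; exact: bmeas_crossing.
- by move=> i; rewrite expect_crossing.
- move=> w /(crossing_weight_gt0 rho0)[r1 r2 _].
  by apply: convA; [exact: crossing_coef01|exact: Af|exact: Af].
- move=> w /(crossing_weight_gt0 rho0)[r1 r2 cu] i.
  rewrite ltnS leq_eqVlt => /predU1P[/val_inj ->|ik]; last first.
    by rewrite /crossing !fp//; ring.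
  by apply/eqP; rewrite -subr_eq0 -cu /crossing /u; apply/eqP; ring.
Qed.

Lemma barycenter d (T : measurableType d) (P : probability T R)
    (rho : T -> R) (f : 'I_n -> T -> R) :
  bmeas rho -> (forall x, 0 <= rho x) -> \int[P]_x rho x = 1 ->
  (forall i, bmeas (f i)) -> (forall x, A (f ^~ x)) ->
  A (fun i => \int[P]_x (rho x * f i x)).
Proof.
move=> brho rho0 rho1 bf Af; set p := fun i => _.
have : forall k, (k <= n)%N -> mean_on p k.
  elim=> [_|k IH kn]; last exact: (@mean_onS p (Ordinal kn) (IH (ltnW kn))).
  by exists d, T, P, rho, f; split.
move=> /(_ n (leqnn n))[d' [T' [Q [r [g [[br r0 r1] bg Eg Ag gp]]]]]].
(* A density of mass one is positive somewhere, and at such a point all [n] coordinates agree with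
   [p]. *)
have [x rx] : exists x, 0 < r x.
  apply/not_existsP => rN; have r00 : r = fun=> 0.
    by apply/funext => x; apply/eqP; rewrite eq_le r0 andbT leNgt; apply/negP/rN.
  by move: r1; rewrite r00 expect_cst => /eqP; rewrite eq_sym oner_eq0.
by rewrite (_ : p = g ^~ x); [exact: Ag|apply/funext => i; rewrite gp].
Qed.

End barycenter.

(** * The payoff curve *)

(** Types lie in [0, 1] almost surely; clipping makes affine functions of the type bounded on the
    whole line, hence [bmeas]. *)
Definition clip (R : realType) (x : measurableTypeR R) : R := if 0 <= x <= 1 then x else 0.

Lemma clip_id (R : realType) (x : R) : 0 <= x <= 1 -> clip x = x.
Proof. by rewrite /clip => ->. Qed.

Lemma clip01 (R : realType) (x : R) : 0 <= clip x <= 1.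
Proof. by rewrite /clip; case: ifP => // _; rewrite lexx ler01. Qed.

Lemma bmeas_clip (R : realType) : bmeas (@clip R).
Proof.
apply: (@bmeas_le _ _ _ _ 1); last exact: clip01.
apply: measurable_fun_ifT => //; apply: measurable_and.
  exact: measurable_fun_ler.
exact: measurable_fun_ler.
Qed.

Lemma Rintegral_clip (R : realType) (F : probability (measurableTypeR R) R)
    (D : set (measurableTypeR R)) (g h : R -> R) :
  D `<=` `[0, 1] -> (forall x, D x -> g x = h x) ->
  \int[F]_(x in D) g x = \int[F]_x ((x \in D)%:R * h (clip x)).
Proof.
move=> D01 gh; rewrite Rintegral_mkcond; apply: eq_Rintegral => x _.
rewrite patchE; case: ifPn => [/set_mem Dx|_]; last by rewrite mul0r.
have := D01 _ Dx; rewrite /= in_itv/= => x01.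
by rewrite mul1r clip_id// gh.
Qed.

Section curve.
Variables (R : realType) (L H : R) (F : probability (measurableTypeR R) R).
Hypotheses (hL : 0 < L) (hLH : L < H) (hmu0 : 0 < prior_mean F < 1).
Variable Theta : set (measurableTypeR R).
Hypotheses (mTheta : measurable Theta) (Theta01 : Theta `<=` `[0, 1]%classic).
Hypothesis FTheta : F Theta = 1%:E.
Local Notation m := (prior_mean F).

Let m0 : 0 < m. Proof. by case/andP: hmu0. Qed.
Let m1 : 0 < 1 - m. Proof. by rewrite subr_gt0; case/andP: hmu0. Qed.
Let H0 : 0 < H. Proof. exact: lt_trans hLH. Qed.
Let HL : 0 < H - L. Proof. by rewrite subr_gt0. Qed.

Lemma ae_Theta : {ae F, forall x, Theta x}.
Proof.
exists (~` Theta); split. exact: measurableC.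
  have := @probability_setC _ _ _ F _ mTheta; rewrite FTheta subee//.
by move=> x.
Qed.

Lemma ae_01 : {ae F, forall x : measurableTypeR R, 0 <= (x : R) <= 1}.
Proof. by apply: filterS ae_Theta => x /Theta01; rewrite /= in_itv. Qed.

(** The part of [type_density] that comes from [v = H]: the joint density of the type and the event
    [v = H], given the basic posterior [mu]. *)
Definition high_weight (mu theta : R) := theta * mu / m.

(** Probability that type [theta] posts [L] at a realization with threshold [c], when the type equal
    to [c] posts [L] with probability [lam]. *)
Definition low_share (c lam theta : R) : R :=
  if theta < c then 1 else if theta == c then lam else 0.

Lemma type_density_ge0 mu theta : 0 <= mu <= 1 -> 0 <= theta <= 1 ->
  0 <= type_density F mu theta.
Proof.
move=> /andP[u0 u1] /andP[t0 t1].
by rewrite addr_ge0// divr_ge0 ?mulr_ge0 ?subr_ge0// ltW// -subr_gt0.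
Qed.

Lemma high_weight_le mu theta : 0 <= mu <= 1 -> 0 <= theta <= 1 ->
  0 <= high_weight mu theta <= type_density F mu theta.
Proof.
move=> /andP[u0 u1] /andP[t0 t1].
rewrite /high_weight /type_density lerDl.
by rewrite !divr_ge0 ?mulr_ge0 ?subr_ge0// ltW// -subr_gt0.
Qed.

(** Bayes' rule freed of its denominator. Where the density is 0, the bounds of [high_weight_le]
    make both sides 0, whatever value 0 / 0 is given. *)
Lemma t_density mu theta : 0 <= mu <= 1 -> 0 <= theta <= 1 ->
  t F mu theta * type_density F mu theta = high_weight mu theta.
Proof.
move=> u01 t01; have d0 := type_density_ge0 u01 t01.
have /andP[h0 hd] := high_weight_le u01 t01.
have m0' := lt0r_neq0 m0; have m1' := lt0r_neq0 m1.
have dE : theta * mu * (1 - m) + (1 - theta) * (1 - mu) * m =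
    type_density F mu theta * (m * (1 - m)).
  by rewrite /type_density; field; rewrite ?m0' ?m1'.
have [d00|dn] := eqVneq (type_density F mu theta) 0.
  by rewrite d00 mulr0; apply/eqP; rewrite eq_sym eq_le h0 andbT -d00.
rewrite /t dE; move: dn; set dd := type_density F mu theta => dn.
by rewrite /high_weight; field; rewrite ?m0' ?m1' ?dn.
Qed.

Lemma threshold01 mu : 0 <= mu <= 1 -> 0 <= threshold L H F mu <= 1.
Proof.
move=> /andP[u0 u1]; rewrite /threshold; case: ifP => _; first by rewrite ler01 lexx.
case: ifP => _; first by rewrite ler01 lexx.
by case: xgetP => [x _ []//|_]; rewrite ler01 lexx.
Qed.

(* The indifference condition [t mu c = L / H] without division, so that it also
   covers the conventions at [mu = 0] and [mu = 1]. *)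
Lemma threshold_char mu c : 0 <= mu <= 1 -> 0 <= c <= 1 ->
  threshold L H F mu = c <->
  (H - L) * (1 - m) * mu * c = L * m * (1 - mu) * (1 - c).
Proof.
move=> /andP[u0 u1] c01; have m0' := lt0r_neq0 m0; have m1' := lt0r_neq0 m1.
have HL' := lt0r_neq0 HL; have L' := lt0r_neq0 hL; have H' := lt0r_neq0 H0.
have [->|un0] := eqVneq mu 0.
  rewrite /threshold eqxx mulr0 mul0r subr0 mulr1; split=> [<-|/esym/eqP].
    by rewrite subrr mulr0.
  by rewrite !mulf_eq0 (negPf L') (negPf m0') subr_eq0 => /eqP.
have [->|un1] := eqVneq mu 1.
  rewrite /threshold eqxx oner_eq0 subrr mulr0 mul0r mulr1; split=> [<-|/eqP].
    by rewrite mulr0.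
  by rewrite !mulf_eq0 (negPf HL') (negPf m1') => /eqP.
have uu : 0 < mu < 1 by rewrite !lt_neqAle eq_sym un0 u0 un1 u1.
have tP := thresholdP hL hLH hmu0 uu c01.
have /andP[u0' u1'] := uu; have /andP[c0 c1] := c01.
have e0 : 0 < c * mu * (1 - m) + (1 - c) * (1 - mu) * m.
  have [->|cn1] := eqVneq c 1.
    by rewrite mul1r subrr !mul0r addr0 mulr_gt0.
  apply: ltr_wpDl; first by rewrite !mulr_ge0// ltW.
  by rewrite !mulr_gt0// ?subr_gt0// lt_neqAle cn1.
split=> [/esym/tP/eqP|e].
  by rewrite /t eqr_div ?lt0r_neq0// => /eqP; lra.
by apply/esym/tP/eqP; rewrite /t eqr_div ?lt0r_neq0//; apply/eqP; lra.
Qed.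

(** The revenues from [L] and from [H], weighted by the density of the type, are affine in [theta]
    and by [threshold_char] agree at the threshold; [price_gap_coef] gives the sign of the slope. *)
Lemma price_gap mu theta : 0 <= mu <= 1 ->
  (L * type_density F mu theta - H * high_weight mu theta) * (m * (1 - m)) =
  ((H - L) * (1 - m) * mu + L * m * (1 - mu)) * (threshold L H F mu - theta).
Proof.
move=> u01; have c01 := threshold01 u01.
have /(threshold_char u01 c01) := erefl (threshold L H F mu).
have m0' := lt0r_neq0 m0; have m1' := lt0r_neq0 m1.
set c := threshold _ _ _ _ => e.
transitivity (L * m * (1 - theta) * (1 - mu) - (H - L) * (1 - m) * theta * mu).
  by rewrite /type_density /high_weight; field; rewrite ?m0' ?m1'.
lra.
Qed.

Lemma price_gap_coef mu : 0 <= mu <= 1 ->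
  0 < (H - L) * (1 - m) * mu + L * m * (1 - mu).
Proof.
move=> /andP[u0 u1]; have [->|un1] := eqVneq mu 1.
  by rewrite mulr1 subrr mulr0 addr0 mulr_gt0.
apply: ltr_wpDl; first by rewrite !mulr_ge0// ltW.
by rewrite !mulr_gt0// subr_gt0 lt_neqAle un1.
Qed.

Lemma price_gap_lt mu theta : 0 <= mu <= 1 ->
  (H * high_weight mu theta < L * type_density F mu theta) =
  (theta < threshold L H F mu).
Proof.
move=> u01; rewrite -subr_gt0 -(pmulr_lgt0 _ (mulr_gt0 m0 m1)) price_gap//.
by rewrite pmulr_rgt0 ?price_gap_coef// subr_gt0.
Qed.

Lemma price_gap_eq mu theta : 0 <= mu <= 1 -> theta = threshold L H F mu ->
  L * type_density F mu theta = H * high_weight mu theta.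
Proof.
move=> u01 e; apply/eqP; rewrite -subr_eq0.
have mm : m * (1 - m) != 0 by rewrite gt_eqF// mulr_gt0.
by apply/eqP/(mulIf mm); rewrite price_gap// e subrr mulr0 mul0r.
Qed.

Lemma bmeas_affine (a b : R) : bmeas (fun x : measurableTypeR R => a * clip x + b).
Proof. by apply: bmeasD; [apply: bmeasM; [|exact: bmeas_clip]|]; exact: bmeas_cst. Qed.

Lemma bmeas_high_weight mu :
  bmeas (fun x : measurableTypeR R => high_weight mu (clip x)).
Proof.
rewrite (_ : (fun _ => _) = fun x : measurableTypeR R => mu / m * clip x + 0).
  exact: bmeas_affine.
by apply/funext => x; rewrite /high_weight; ring.
Qed.

Lemma bmeas_type_density mu :
  bmeas (fun x : measurableTypeR R => type_density F mu (clip x)).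
Proof.
rewrite (_ : (fun _ => _) = fun x : measurableTypeR R =>
    (mu / m - (1 - mu) / (1 - m)) * clip x + (1 - mu) / (1 - m)).
  exact: bmeas_affine.
by apply/funext => x; rewrite /type_density; ring.
Qed.

Lemma bmeas_low_share c lam :
  bmeas (fun x : measurableTypeR R => low_share c lam x).
Proof.
apply: bmeas_if; [exact: measurable_fun_ltr|exact: bmeas_cst|].
by apply: bmeas_if; [exact: measurable_fun_eqr|exact: bmeas_cst|exact: bmeas_cst].
Qed.

Lemma bmeas_mem (D : set (measurableTypeR R)) : measurable D ->
  bmeas (fun x : measurableTypeR R => (x \in D)%:R : R).
Proof.
move=> mD; rewrite (_ : (fun _ => _) = \1_D); last by apply/funext => x; rewrite indicE.
apply: (@bmeas_le _ _ _ _ 1); first exact: measurable_indic.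
by move=> x; rewrite indicE; case: (_ \in _); rewrite ?ler01 ?lexx.
Qed.

(** Merges the pieces of the domain, the atom at the threshold included, into the factor
    [low_share], and removes the quotient [t] by [t_density]. The integrands agree on [0, 1], which
    carries [F]. *)
Lemma U_expect lam mu : 0 <= mu <= 1 -> U L H F lam mu =
  \int[F]_x (low_share (threshold L H F mu) lam x
             * ((H - L) * high_weight mu (clip x))).
Proof.
move=> u01; have /andP[c0 c1] := threshold01 u01.
set c := threshold _ _ _ _ in c0 c1 *.
have tE x : 0 <= x <= 1 ->
    t F mu x * (H - L) * type_density F mu x = (H - L) * high_weight mu x.
  by move=> x01; rewrite mulrAC t_density// mulrC.
have bg : bmeas (fun x : measurableTypeR R => (H - L) * high_weight mu (clip x)).
  by apply: bmeasM; [exact: bmeas_cst|exact: bmeas_high_weight].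
have b1 := bmeas_mem (measurable_itv `[0, c[).
have b2 := bmeas_mem (measurable_set1 (c : measurableTypeR R)).
rewrite /U /integral_given -/c.
have s1 : [set c : measurableTypeR R] `<=` `[0, 1].
  by move=> x /= ->; rewrite in_itv/= c0.
have s2 : `[0, c[ `<=` (`[0, 1] : set (measurableTypeR R)).
  by move=> x /=; rewrite !in_itv/= => /andP[-> /ltW/le_trans->].
rewrite (Rintegral_clip F (h := fun x => (H - L) * high_weight mu x) s2); last first.
  by move=> x /s2 /=; rewrite in_itv => /tE.
rewrite (Rintegral_clip F (h := fun x => (H - L) * high_weight mu x) s1); last first.
  by move=> x /s1 /=; rewrite in_itv => /tE.
have b4 := bmeasM b1 bg; have b5 := bmeasM b2 bg.
have b6 := bmeasM (bmeas_cst _ lam) b5.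
rewrite -(expectZl F lam b5) -(expectD F b4 b6); apply: eq_expect_ae.
- exact: bmeasD b4 b6.
- by apply: bmeasM => //; exact: bmeas_low_share.
apply: filterS ae_01 => x /andP[x0 x1]; rewrite /low_share.
rewrite !mem_setE /= in_itv/= x0 in_set1.
by case: (ltrgtP x c) => _ /=; ring.
Qed.

Lemma Pi_expect lam mu : 0 <= mu <= 1 -> Pi L H F lam mu =
  \int[F]_x (low_share (threshold L H F mu) lam x
             * (L * type_density F mu (clip x))
             + (1 - low_share (threshold L H F mu) lam x)
               * (H * high_weight mu (clip x))).
Proof.
move=> u01; have /andP[c0 c1] := threshold01 u01.
set c := threshold _ _ _ _ in c0 c1 *.
have tE x : 0 <= x <= 1 ->
    t F mu x * H * type_density F mu x = H * high_weight mu x.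
  by move=> x01; rewrite mulrAC t_density// mulrC.
have bg : bmeas (fun x : measurableTypeR R => H * high_weight mu (clip x)).
  by apply: bmeasM; [exact: bmeas_cst|exact: bmeas_high_weight].
have bd : bmeas (fun x : measurableTypeR R => L * type_density F mu (clip x)).
  by apply: bmeasM; [exact: bmeas_cst|exact: bmeas_type_density].
have b1 := bmeas_mem (measurable_itv `[0, c[).
have b2 := bmeas_mem (measurable_set1 (c : measurableTypeR R)).
have b3 := bmeas_mem (measurable_itv `]c, 1]).
rewrite /Pi /integral_given -/c.
have s1 : [set c : measurableTypeR R] `<=` `[0, 1].
  by move=> x /= ->; rewrite in_itv/= c0.
have s2 : `[0, c[ `<=` (`[0, 1] : set (measurableTypeR R)).
  by move=> x /=; rewrite !in_itv/= => /andP[-> /ltW/le_trans->].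
have s3 : `]c, 1] `<=` (`[0, 1] : set (measurableTypeR R)).
  by move=> x /=; rewrite !in_itv/= => /andP[/ltW/(le_trans c0) -> ->].
rewrite (Rintegral_clip F (h := fun x => L * type_density F mu x) s2)//.
rewrite (Rintegral_clip F (h := fun x => L * type_density F mu x) s1)//.
rewrite (Rintegral_clip F (h := fun x => H * high_weight mu x) s3); last first.
  by move=> x /s3 /=; rewrite in_itv => /tE.
rewrite (Rintegral_clip F (h := fun x => H * high_weight mu x) s1); last first.
  by move=> x /s1 /=; rewrite in_itv => /tE.
have b4 := bmeasM b1 bd; have b5 := bmeasM b2 bd.
have b6 := bmeasM b3 bg; have b7 := bmeasM b2 bg.
have b8 := bmeasM (bmeas_cst _ lam) b5.
have b9 := bmeasM (bmeas_cst _ (1 - lam)) b7.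
rewrite -(expectZl F lam b5) -(expectZl F (1 - lam) b7).
rewrite -(expectD F b4 b6) -(expectD F b8 b9) -(expectD F (bmeasD b4 b6) (bmeasD b8 b9)).
have bs := bmeas_low_share c lam.
apply: eq_expect_ae.
- exact: bmeasD (bmeasD b4 b6) (bmeasD b8 b9).
- by apply: bmeasD; apply: bmeasM => //; exact: bmeasB (bmeas_cst _ _) bs.
apply: filterS ae_01 => x /andP[x0 x1]; rewrite /low_share.
rewrite !mem_setE /= !in_itv/= x0 x1 in_set1.
by case: (ltrgtP x c) => _ /=; ring.
Qed.

End curve.

(** * The conjugate of a convex profit function *)

(** Cut [0, y] into [n.+1] equal steps: the bounds telescope to at most y / (n + 1) because [c]
    takes values in [0, 1]. This serves to integrate a subgradient without differentiating. *)
Lemma eq_of_small_increments (R : realType) (D c : R -> R) (H : R) : 0 < H ->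
  (forall x, 0 <= c x <= 1) ->
  (forall x y, 0 <= x -> x <= y -> y <= H ->
     `|D y - D x| <= (c y - c x) * (y - x)) ->
  forall y, 0 <= y <= H -> D y = D 0.
Proof.
move=> H0 c01 Dc y /andP[y0 yH]; apply/eqP; rewrite -subr_eq0 -normr_eq0.
rewrite eq_le normr_ge0 andbT leNgt; apply/negP => e0.
set e := `|_| in e0.
have [n nP] : exists n : nat, y / e < n.+1%:R.
  exists (Num.truncn (y / e)); rewrite Num.Theory.truncnS_gt//.
  have h0 : (0 : R) < n.+1%:R by rewrite ltr0n.
pose x (i : nat) : R := y * i%:R / n.+1%:R.
have xi i : x i.+1 - x i = y / n.+1%:R.
  by rewrite /x -mulrBl -mulrBr -natrB// subSnn mulr1.
have : e <= \sum_(0 <= i < n.+1) ((c (x i.+1) - c (x i)) * (y / n.+1%:R)).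
  rewrite /e (_ : D y - D 0 = \sum_(0 <= i < n.+1) (D (x i.+1) - D (x i))).
    apply: (le_trans (ler_norm_sum _ _ _)).
    rewrite !big_nat; apply: ler_sum => i /andP[_ iN].
    rewrite -(xi i); apply: Dc.
    - by rewrite /x divr_ge0// mulr_ge0.
    - by rewrite -subr_ge0 xi divr_ge0.
    - rewrite /x (le_trans _ yH)// ler_pdivrMr// ler_wpM2l//.
      by rewrite ler_nat.
  by rewrite telescope_sumr// /x mulr0 mul0r mulfK// gt_eqF.
rewrite -mulr_suml telescope_sumr//.
have : (c (x n.+1) - c (x 0%N)) * (y / n.+1%:R) <= y / n.+1%:R.
  rewrite ler_piMl ?divr_ge0//.
  have /andP[_ a1] := c01 (x n.+1); have /andP[b0 _] := c01 (x 0%N).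
  by rewrite lerBlDr (le_trans a1)// lerDl.
move=> /[swap] /le_trans /[apply]; rewrite leNgt => /negP; apply.
by move: nP; rewrite ltr_pdivrMr// ltr_pdivrMr// mulrC.
Qed.

Lemma dist_le_itv (R : realDomainType) (a b k w : R) :
  a <= k -> k <= b -> a <= w -> w <= b -> `|k - w| <= b - a.
Proof. by move=> *; rewrite ler_norml; apply/andP; split; lra. Qed.

(** * The uniform law on [0, H] *)

Section uniform.
Context (R : realType) (H : R) (H0 : 0 < H).
Local Notation P := (uniform_prob H0).

Lemma uniform_ne (a : R) : {ae P, forall p : measurableTypeR R, p != a}.
Proof.
exists [set a]; split; [exact: measurable_set1| |].
  have /null_content_dominatesP := dominates_uniform_prob H0.
  by apply; [exact: measurable_set1|exact: lebesgue_measure_set1].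
by move=> p /= /negP; rewrite negbK => /eqP.
Qed.

Lemma expect_uniform_itv (x y : R) : 0 <= x -> x <= y -> y <= H ->
  \int[P]_p ((x < p <= y)%R%:R) = (y - x) / H.
Proof.
move=> x0 xy yH.
have mxy : measurable (`]x, y] : set (measurableTypeR R)) by exact: measurable_itv.
transitivity (\int[P]_p (\1_(`]x, y] : set (measurableTypeR R)) p : R)).
  by apply: eq_Rintegral => p _; rewrite indicE mem_setE in_itv.
rewrite /Rintegral integral_uniform; last 2 first.
- by apply/measurable_EFinP; exact: measurable_indic.
- by move=> p; rewrite lee_fin.
rewrite integral_indic// subr0.
have -> : `]x, y]%classic `&` `[0, H]%classic = `]x, y]%classic :> set R.
  apply/setIidl => p /=; rewrite !in_itv/= => /andP[xp py].
  by rewrite (le_trans x0 (ltW xp)) (le_trans py yH).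
have lxy : lebesgue_measure (`]x, y]%classic : set R) = (y - x)%:E.
  rewrite (lebesgue_measure_itv (`]x, y]%R : interval R))/= lte_fin.
  case: ltP => // yx; have -> : y = x by apply/eqP; rewrite eq_le yx.
  by rewrite subrr.
by rewrite [X in (_ * X)%E]lxy -EFinM/= mulrC.
Qed.

Lemma ae_uniform : {ae P, forall p : measurableTypeR R, 0 < (p : R) <= H}.
Proof.
have b : bmeas (fun p : measurableTypeR R => (0 < (p : R) <= H)%R%:R : R).
  apply: bmeas_bool; apply: measurable_and; first exact: measurable_fun_ltr.
  exact: measurable_fun_ler.
have b1 := bmeasB (bmeas_cst _ 1) b.
have : \int[P]_p (1 - (0 < (p : R) <= H)%R%:R) = 0.
  rewrite expectB//; last exact: bmeas_cst.
  by rewrite expect_uniform_itv// ?ltW// expect_cst subr0 divff ?subrr// gt_eqF.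
move=> /(expect_eq0 b1) ae0.
apply: filterS (ae0 _) => [p|p]; last by case: (_ < _ <= _); rewrite ?subr0 ?subrr.
by case: (_ < _ <= _) => // /eqP; rewrite subr0 oner_eq0.
Qed.

End uniform.

Section conjugate.
Context (R : realType) (L H : R).
Hypothesis H0 : 0 < H.
Local Notation P := (uniform_prob H0).
Variables (V : R -> R).
Hypotheses (Vc : continuous V) (VL : forall x, 0 <= x <= 1 -> L <= V x)
  (VH : forall x, 0 <= x <= 1 -> H * x <= V x) (V0 : V 0 = L) (V1 : V 1 = H).

Lemma argmax_exists : exists c : R -> R, forall p,
  0 <= c p <= 1 /\ forall x, 0 <= x <= 1 -> p * x - V x <= p * c p - V (c p).
Proof.
suff /boolp.choice[c cP] : forall p : R, exists c : R, 0 <= c <= 1 /\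
    forall x, 0 <= x <= 1 -> p * x - V x <= p * c - V c by exists c.
move=> p.
have cf : {within `[0, 1], continuous (fun x : R => p * x - V x)}.
  apply: continuous_subspaceT => x; apply: cvgB; last exact: Vc.
  exact: mulrl_continuous.
have [c c01 cP] := EVT_max ler01 cf.
exists c; split; first by move: c01; rewrite in_itv.
by move=> x x01; apply: cP; rewrite in_itv.
Qed.

Variable c : R -> R.
Hypothesis c01 : forall p, 0 <= c p <= 1.
Hypothesis cP : forall p x, 0 <= x <= 1 -> p * x - V x <= p * c p - V (c p).

Let W p := p * c p - V (c p).

(** The maximizer at [p] is still feasible at [p']. *)
Lemma conj_subgrad p p' : W p + (p' - p) * c p <= W p'.
Proof. by rewrite /W; have := cP p' (c01 p); lra. Qed.

(** Add the subgradient inequalities from [p] to [p'] and back. *)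
Lemma argmax_nd p p' : p <= p' -> c p <= c p'.
Proof.
rewrite le_eqVlt => /predU1P[->//|pp].
have := conj_subgrad p p'; have := conj_subgrad p' p => a b.
rewrite -subr_ge0 -(pmulr_rge0 _ (_ : 0 < p' - p)) ?subr_gt0//; lra.
Qed.

Lemma argmax_measurable : measurable_fun setT (c : measurableTypeR R -> R).
Proof.
by apply: nondecreasing_measurable => // x y; exact: argmax_nd.
Qed.

Lemma bmeas_argmax : bmeas (c : measurableTypeR R -> R).
Proof. exact: bmeas_le argmax_measurable c01. Qed.

Lemma conj0 : W 0 = - L.
Proof.
have x0 : 0 <= (0 : R) <= 1 by rewrite lexx ler01.
have := cP 0 x0; rewrite V0 /W => a; have := VL (c01 0) => b; lra.
Qed.

Lemma conjH : W H = 0.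
Proof.
have x1 : 0 <= (1 : R) <= 1 by rewrite lexx ler01.
have := cP H x1; rewrite V1 /W => a; have := VH (c01 H) => b; lra.
Qed.

(** The integrated form of W' = c, with [W 0 = - L]. Over a step from [x] to [z] the increments of
    [H] times the integral and of [W] both lie between [c x * (z - x)] and [c z * (z - x)], so their
    difference [D] is constant by [eq_of_small_increments]. *)
Lemma expect_argmax_le y : 0 <= y <= H ->
  \int[P]_p ((p <= y)%R%:R * c p) = (W y + L) / H.
Proof.
move=> y0H; pose D y := H * (\int[P]_p ((p <= y)%R%:R * c p)) - W y.
have bc := bmeas_argmax.
have mle (z : R) : measurable_fun setT (fun p : measurableTypeR R => p <= z).
  exact: measurable_fun_ler.
have ble z := bmeas_bool R (mle z).
have bxy x z : bmeas (fun p : measurableTypeR R => (x < p <= z)%R%:R : R).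
  by apply: bmeas_bool; apply: measurable_and; [exact: measurable_fun_ltr|exact: mle].
have DE x z : 0 <= x -> x <= z -> z <= H ->
    H * \int[P]_p ((p <= z)%R%:R * c p) - H * \int[P]_p ((p <= x)%R%:R * c p) =
    H * \int[P]_p ((x < p <= z)%R%:R * c p).
  move=> x0 xz zH; rewrite -mulrBr -expectB; [|exact: bmeasM..].
  congr (_ * _); apply: eq_Rintegral => p _; rewrite -mulrBl; congr (_ * _).
  have [px|xp] /= := leP p x; first by rewrite (le_trans px xz) subrr.
  by rewrite subr0.
have : D y = D 0.
  apply: (@eq_of_small_increments _ _ c H H0 c01) => // x z x0 xz zH.
  have -> : D z - D x = H * \int[P]_p ((x < p <= z)%R%:R * c p) - (W z - W x).
    by rewrite -DE// /D; ring.
  have cI k : H * \int[P]_p ((x < p <= z)%R%:R * k) = k * (z - x).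
    by rewrite expectZr// expect_uniform_itv//; field; rewrite gt_eqF.
  have lo : c x * (z - x) <= H * \int[P]_p ((x < p <= z)%R%:R * c p).
    rewrite -cI ler_pM2l//; apply: le_expect => [||p].
    - exact: bmeasM (bxy x z) (bmeas_cst _ _).
    - exact: bmeasM.
    case: (boolP (x < p <= z)) => [/andP[xp _]|_]; last by rewrite !mul0r.
    by rewrite !mul1r argmax_nd// ltW.
  have hi : H * \int[P]_p ((x < p <= z)%R%:R * c p) <= c z * (z - x).
    rewrite -cI ler_pM2l//; apply: le_expect => [||p].
    - exact: bmeasM.
    - exact: bmeasM (bxy x z) (bmeas_cst _ _).
    case: (boolP (x < p <= z)) => [/andP[_ pz]|_]; last by rewrite !mul0r.
    by rewrite !mul1r argmax_nd.
  rewrite mulrBl; apply: dist_le_itv => //.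
    by rewrite lerBrDl mulrC conj_subgrad.
  rewrite lerBlDl; have := conj_subgrad z x.
  by rewrite -[x - z]opprB mulNr (mulrC _ (c z)) lerBlDr.
have -> : D 0 = L.
  rewrite /D conj0 opprK (_ : \int[P]_p _ = 0) ?mulr0 ?add0r//.
  apply: etrans (expect_cst P 0); apply: eq_expect_ae; [exact: bmeasM|exact: bmeas_cst|].
  by apply: filterS (ae_uniform H0) => p /andP[p0 _]; rewrite leNgt p0 mul0r.
rewrite /D => /eqP; rewrite subr_eq => /eqP e.
apply: (mulfI (lt0r_neq0 H0)); rewrite e mulrC divfK ?lt0r_neq0//.
by rewrite addrC.
Qed.

End conjugate.

(** * From a convex profit function to the hull *)

Lemma conv_convex_hull (R : realType) (V : lmodType R) (A : set V) (x y : V) (s : R) :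
  0 <= s <= 1 -> convex_hull A x -> convex_hull A y ->
  convex_hull A (s *: x + (1 - s) *: y).
Proof.
move=> /andP[s0 s1] Ax Ay B [cB AB].
have xB : x \in B by apply/mem_set; exact: Ax.
have yB : y \in B by apply/mem_set; exact: Ay.
exact/set_mem/(cB x y (Itv01 s0 s1) xB yB).
Qed.

Lemma sub_convex_hull (R : realType) (V : lmodType R) (A : set V) :
  A `<=` convex_hull A.
Proof. by move=> x Ax B [_]; exact. Qed.

(** * From a profit function and its subgradients to one signal *)

Section core.
Variables (R : realType) (L H : R) (F : probability (measurableTypeR R) R).
Hypotheses (hL : 0 < L) (hLH : L < H) (hmu0 : 0 < prior_mean F < 1).
Variable Theta : set (measurableTypeR R).
Hypotheses (mTheta : measurable Theta) (Theta01 : Theta `<=` `[0, 1]%classic).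
Hypothesis FTheta : F Theta = 1%:E.
Local Notation m := (prior_mean F).
Let m0 : 0 < m. Proof. by case/andP: hmu0. Qed.
Let m1 : 0 < 1 - m. Proof. by rewrite subr_gt0; case/andP: hmu0. Qed.
Let H0 : 0 < H. Proof. exact: lt_trans hLH. Qed.
Let HL : 0 < H - L. Proof. by rewrite subr_gt0. Qed.
Local Notation P := (uniform_prob H0).

Variables (V : R -> R).
Hypotheses (Vc : continuous V) (VL : forall x, 0 <= x <= 1 -> L <= V x)
  (VH : forall x, 0 <= x <= 1 -> H * x <= V x) (V0 : V 0 = L) (V1 : V 1 = H).
Variable pbar : measurableTypeR R -> R.
Hypothesis mpbar : measurable_fun setT pbar.
Hypothesis pbar0H : forall x, Theta x -> 0 <= pbar x <= H.
Hypothesis pbarP : forall x y, Theta x -> 0 <= y <= 1 ->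
  V x + pbar x * (y - x) <= V y.

Variable c : R -> R.
Hypothesis c01 : forall p, 0 <= c p <= 1.
Hypothesis cP : forall p x, 0 <= x <= 1 -> p * x - V x <= p * c p - V (c p).
Let W p := p * c p - V (c p).

Let T01 x : Theta x -> 0 <= x <= 1.
Proof. by move=> /Theta01; rewrite /= in_itv. Qed.

(** Equality in Fenchel's inequality: [pbar x] is a subgradient of [V] at [x], so [x] itself attains
    the maximum. *)
Lemma conj_pbar x : Theta x -> W (pbar x) = pbar x * x - V x.
Proof.
move=> Tx; apply/eqP; rewrite eq_le cP ?T01// andbT /W.
have := pbarP Tx (c01 (pbar x)); lra.
Qed.

(** Add the support line of [V] at [x] to the optimality of [c p]: the product of [pbar x - p] and
    [x - c p] is nonnegative. *)
Lemma argmax_le p x : Theta x -> p < pbar x -> c p <= x.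
Proof.
move=> Tx px; have := pbarP Tx (c01 p); have := cP p (T01 Tx) => a b.
rewrite -subr_ge0 -(pmulr_rge0 _ (_ : 0 < pbar x - p)) ?subr_gt0//; lra.
Qed.

Lemma argmax_ge p x : Theta x -> pbar x < p -> x <= c p.
Proof.
move=> Tx px; have := pbarP Tx (c01 p); have := cP p (T01 Tx) => a b.
rewrite -subr_ge0 -(pmulr_rge0 _ (_ : 0 < p - pbar x)) ?subr_gt0//; lra.
Qed.

(** The type equal to [c p] is indifferent at [p]; this choice makes him too post [H] exactly when
    [p] is strictly below his [pbar]. *)
Definition tie (p : measurableTypeR R) : R := (pbar (c p) <= p)%R%:R.

Let mc : measurable_fun setT (c : measurableTypeR R -> R).
Proof. exact: argmax_measurable c01 cP. Qed.
Let bc : bmeas (c : measurableTypeR R -> R).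
Proof. exact: bmeas_argmax c01 cP. Qed.
Let btie : bmeas tie.
Proof.
apply: bmeas_bool; apply: measurable_fun_ler => //.
exact: (measurableT_comp mpbar mc).
Qed.

Let share (w : measurableTypeR R * measurableTypeR R) :=
  low_share (c w.1) (tie w.1) w.2.

Let bshare : bmeas share.
Proof.
have m1' := measurableT_comp mc (@measurable_fst _ _ (measurableTypeR R) (measurableTypeR R)).
have m2' := @measurable_snd _ _ (measurableTypeR R) (measurableTypeR R).
apply: bmeas_if; [exact: measurable_fun_ltr|exact: bmeas_cst|].
apply: bmeas_if; [exact: measurable_fun_eqr| |exact: bmeas_cst].
by apply: bmeas_comp btie; exact: measurable_fst.
Qed.

Let bsnd : bmeas (fun w : measurableTypeR R * measurableTypeR R => clip w.2 : R).
Proof. by apply: (bmeas_comp _ (@bmeas_clip R)); exact: measurable_snd. Qed.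

Let bcfst : bmeas (fun w : measurableTypeR R * measurableTypeR R => c w.1 : R).
Proof. by apply: (bmeas_comp _ bc); exact: measurable_fst. Qed.

(** Off the threshold this is [argmax_le] and [argmax_ge], at the threshold it is [tie]; the single
    realization [pbar x] is null. *)
Lemma share_pbar x : Theta x ->
  {ae P, forall p, 1 - share (p, x) = (p <= pbar x)%R%:R}.
Proof.
move=> Tx; apply: filterS (uniform_ne H0 (pbar x)) => p pne.
rewrite /share /low_share /tie /=.
case: (ltgtP (p : R) (pbar x)) pne => [pl _|pg _|//].
- have := argmax_le Tx pl; rewrite leNgt => /negbTE ->.
  by case: eqVneq => [<-|_]; rewrite ?leNgt ?pl/= ?subr0.
- have := argmax_ge Tx pg; rewrite le_eqVlt => /predU1P[<-|->].
    by rewrite ltxx eqxx (ltW pg) subrr.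
  by rewrite subrr.
Qed.

(** Integral of [c] over all of [0, H], from [W 0 = - L] and [W H = 0]. It normalizes both
    likelihoods below. *)
Lemma expect_argmax : \int[P]_p c p = L / H.
Proof.
have HH : 0 <= H <= H by rewrite lexx ltW.
have := expect_argmax_le H0 VL V0 c01 cP HH.
rewrite (conjH VH V1 c01 cP) add0r => <-.
apply: eq_expect_ae => //.
  by apply: bmeasM => //; apply: bmeas_bool; exact: measurable_fun_ler.
by apply: filterS (ae_uniform H0) => p /andP[_ ->]; rewrite mul1r.
Qed.

Lemma expect_not_share x : Theta x ->
  \int[P]_p ((1 - share (p, x)) * c p) = (pbar x * x - V x + L) / H.
Proof.
move=> Tx; rewrite -conj_pbar// -(expect_argmax_le H0 VL V0 c01 cP (pbar0H Tx)).
have bs := bmeas_pair2 x bshare.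
apply: eq_expect_ae.
- by apply: bmeasM => //; apply: bmeasB => //; exact: bmeas_cst.
- by apply: bmeasM => //; apply: bmeas_bool; exact: measurable_fun_ler.
- by apply: filterS (share_pbar Tx) => p ->.
Qed.

Lemma expect_not_share1 x : Theta x ->
  \int[P]_p (1 - share (p, x)) = pbar x / H.
Proof.
move=> Tx; have /andP[p0 pH] := pbar0H Tx.
have := expect_uniform_itv H0 (lexx 0) p0 pH; rewrite subr0 => <-.
have bs := bmeas_pair2 x bshare.
apply: eq_expect_ae.
- by apply: bmeasB => //; exact: bmeas_cst.
- apply: bmeas_bool; apply: measurable_and; first exact: measurable_fun_ltr.
  exact: measurable_fun_ler.
- by apply: filterS2 (share_pbar Tx) (ae_uniform H0) => p -> /andP[-> _].
Qed.

Lemma expect_share x : Theta x ->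
  \int[P]_p (share (p, x) * (1 - c p)) = (H - pbar x + pbar x * x - V x) / H.
Proof.
move=> Tx.
have bs := bmeas_pair2 x bshare.
have bs1 := bmeasB (bmeas_cst (measurableTypeR R) 1) bs.
have bn := bmeasM bs1 bc.
transitivity (\int[P]_p (1 - c p - (1 - share (p, x)) + (1 - share (p, x)) * c p)).
  by apply: eq_Rintegral => p _; ring.
have b1c := bmeasB (bmeas_cst (measurableTypeR R) 1) bc.
rewrite (expectD P (bmeasB b1c bs1) bn) (expectB P b1c bs1).
rewrite (expectB P (bmeas_cst (measurableTypeR R) 1) bc) expect_cst expect_argmax.
by rewrite expect_not_share1// expect_not_share//; field; rewrite lt0r_neq0.
Qed.

(** Relative to [P], [a1] is the density of the realization given [v = H] and [H * c p / L] the one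
    given [v = L]; [rho] is the density under the prior [m], and [mu] the basic posterior by Bayes'
    rule. *)
Let a1 p := H * (1 - c p) / (H - L).
Let rho p := m * a1 p + (1 - m) * (H * c p / L).
Let mu p := m * a1 p / rho p.

Let a1_ge0 p : 0 <= a1 p.
Proof. by have /andP[_ h] := c01 p; rewrite divr_ge0 ?mulr_ge0 ?subr_ge0// ltW. Qed.

Let rho_gt0 p : 0 < rho p.
Proof.
have /andP[c0 _] := c01 p; rewrite /rho /a1; move: c0; rewrite le_eqVlt.
move=> /predU1P[<-|c0].
  by rewrite subr0 mulr1 mulr0 mul0r mulr0 addr0 mulr_gt0// divr_gt0.
apply: ltr_wpDl; first by rewrite mulr_ge0 ?(ltW m0)//; exact: a1_ge0.
by rewrite !mulr_gt0// invr_gt0.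
Qed.

Let mu01 p : 0 <= mu p <= 1.
Proof.
have /andP[c0 _] := c01 p.
have ma0 : 0 <= m * a1 p by rewrite mulr_ge0 ?(ltW m0)//; exact: a1_ge0.
have r0 := rho_gt0 p.
apply/andP; split; first exact: divr_ge0 ma0 (ltW r0).
rewrite /mu ler_pdivrMr// mul1r /rho lerDl.
by rewrite !mulr_ge0 ?invr_ge0 ?(ltW m1) ?(ltW H0) ?(ltW hL).
Qed.

Let rho_mu p : rho p * mu p = m * a1 p.
Proof. by rewrite /mu mulrCA divff ?mulr1// lt0r_neq0. Qed.

Let rho_mu1 p : rho p * (1 - mu p) = (1 - m) * (H * c p / L).
Proof.
transitivity (rho p - rho p * mu p); first by ring.
by have -> := rho_mu p; rewrite /rho addrC addKr.
Qed.

(** Multiplied by [rho p], both sides of the condition in [threshold_char] become m (1 - m) H c(p)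
    (1 - c(p)); the likelihoods are chosen for this. *)
Let threshold_mu p : threshold L H F (mu p) = c p.
Proof.
apply/(threshold_char hL hLH hmu0 (mu01 p) (c01 p)).
apply: (mulfI (lt0r_neq0 (rho_gt0 p))).
transitivity ((H - L) * (1 - m) * (rho p * mu p) * c p); first by ring.
transitivity (L * m * (rho p * (1 - mu p)) * (1 - c p)); last by ring.
rewrite rho_mu rho_mu1 /a1.
by field; rewrite ?lt0r_neq0.
Qed.

Let rho_high p x : rho p * high_weight F (mu p) x = a1 p * x.
Proof.
have m0' := lt0r_neq0 m0.
transitivity (rho p * mu p * (x / m)); first by rewrite /high_weight; ring.
by rewrite rho_mu; field.
Qed.

Let rho_density p x : rho p * type_density F (mu p) x = a1 p * x + (1 - x) * (H * c p / L).
Proof.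
have m1' := lt0r_neq0 m1.
rewrite /type_density mulrDr [rho p * _]rho_high.
congr (_ + _).
transitivity ((1 - x) / (1 - m) * (rho p * (1 - mu p))); first by ring.
by rewrite rho_mu1; field; rewrite ?m1' ?lt0r_neq0.
Qed.

Let bw (g : R -> R) : bmeas (g : measurableTypeR R -> R) ->
  bmeas (fun w : measurableTypeR R * measurableTypeR R => g w.1).
Proof. by apply: bmeas_comp; exact: measurable_fst. Qed.

Let ba1 : bmeas (a1 : measurableTypeR R -> R).
Proof.
apply: bmeasM; last exact: bmeas_cst.
by apply: bmeasM; [exact: bmeas_cst|exact: bmeasB (bmeas_cst _ _) bc].
Qed.

Let bb : bmeas (fun p : measurableTypeR R => H * c p / L).
Proof. by apply: bmeasM; [apply: bmeasM|]; rewrite //; exact: bmeas_cst. Qed.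

Let brho : bmeas (rho : measurableTypeR R -> R).
Proof. by apply: bmeasD; apply: bmeasM => //; exact: bmeas_cst. Qed.

Let bmu : bmeas (mu : measurableTypeR R -> R).
Proof.
apply: bmeas_le mu01; apply: measurable_fun_div.
- by have [] := bmeasM (bmeas_cst _ m) ba1.
- by case: brho.
Qed.

Let expect_1c : \int[P]_p (1 - c p) = (H - L) / H.
Proof.
rewrite (expectB P (bmeas_cst (measurableTypeR R) 1) bc) expect_cst expect_argmax.
by field; rewrite lt0r_neq0.
Qed.

Let expect_a1 : \int[P]_p a1 p = 1.
Proof.
rewrite /a1; have b1c := bmeasB (bmeas_cst (measurableTypeR R) 1) bc.
rewrite (expectZr P _ (bmeasM (bmeas_cst _ H) b1c)) (expectZl P _ b1c) expect_1c.
by field; rewrite !lt0r_neq0.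
Qed.

Let expect_b : \int[P]_p (H * c p / L) = 1.
Proof.
rewrite (expectZr P _ (bmeasM (bmeas_cst _ H) bc)) (expectZl P _ bc) expect_argmax.
by field; rewrite !lt0r_neq0.
Qed.

Let expect_rho : \int[P]_p rho p = 1.
Proof.
have b1 := bmeasM (bmeas_cst _ m) ba1; have b2 := bmeasM (bmeas_cst _ (1 - m)) bb.
rewrite (expectD P b1 b2) (expectZl P _ ba1) (expectZl P _ bb) expect_a1 expect_b.
by rewrite !mulr1 addrC subrK.
Qed.

Let bmu1 : bmeas (fun w : measurableTypeR R * measurableTypeR R => mu w.1).
Proof. exact: bw. Qed.

Let bone : bmeas (fun _ : measurableTypeR R * measurableTypeR R => 1 : R).
Proof. exact: bmeas_cst. Qed.

Let bhigh : bmeas (fun w : measurableTypeR R * measurableTypeR R =>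
  high_weight F (mu w.1) (clip w.2)).
Proof. by apply: bmeasM; [exact: bmeasM|exact: bmeas_cst]. Qed.

Let bdens : bmeas (fun w : measurableTypeR R * measurableTypeR R =>
  type_density F (mu w.1) (clip w.2)).
Proof.
apply: bmeasD => //; apply: bmeasM; last exact: bmeas_cst.
by apply: bmeasM; exact: bmeasB.
Qed.

Let bU : bmeas (fun w => share w * ((H - L) * high_weight F (mu w.1) (clip w.2))).
Proof. by apply: bmeasM => //; apply: bmeasM => //; exact: bmeas_cst. Qed.

Let bPi : bmeas (fun w => share w * (L * type_density F (mu w.1) (clip w.2))
  + (1 - share w) * (H * high_weight F (mu w.1) (clip w.2))).
Proof.
apply: bmeasD; apply: bmeasM => //; last 1 first.
- by apply: bmeasM => //; exact: bmeas_cst.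
- by apply: bmeasM => //; exact: bmeas_cst.
- exact: bmeasB.
Qed.

Let UE p : U L H F (tie p) (mu p) =
  \int[F]_x (share (p, x) * ((H - L) * high_weight F (mu p) (clip x))).
Proof. by rewrite (U_expect _ _ hmu0 mTheta Theta01 FTheta)// threshold_mu. Qed.

Let PiE p : Pi L H F (tie p) (mu p) =
  \int[F]_x (share (p, x) * (L * type_density F (mu p) (clip x))
    + (1 - share (p, x)) * (H * high_weight F (mu p) (clip x))).
Proof. by rewrite (Pi_expect _ _ hmu0 mTheta Theta01 FTheta)// threshold_mu. Qed.

(** Integrate first over realizations at a fixed type [x]: [rho] times [high_weight] is [a1 p * x],
    and the rent reduces to the mean in [expect_share]. *)
Lemma expect_U (X : measurableTypeR R -> R) : bmeas X ->
  (forall x, Theta x -> X x = x * (H - V x - (1 - x) * pbar x)) ->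
  \int[P]_p (rho p * U L H F (tie p) (mu p)) = \int[F]_x X x.
Proof.
move=> bX XE.
pose h w := share w * ((1 - c w.1) * (H * clip w.2)).
have b1c := bmeasB bone bcfst.
have bh : bmeas h.
  by apply: bmeasM => //; apply: bmeasM => //; apply: bmeasM => //; exact: bmeas_cst.
transitivity (\int[P]_p \int[F]_x h (p, x)).
  apply: eq_Rintegral => p _; rewrite UE -expectZl; last exact: (bmeas_pair1 p bU).
  apply: eq_Rintegral => x _.
  transitivity (share (p, x) * (H - L) * (rho p * high_weight F (mu p) (clip x))).
    by ring.
  by rewrite rho_high /a1 /h/=; field; rewrite lt0r_neq0.
rewrite (expect_swap P F bh); apply: eq_expect_ae => //.
  exact: (bmeas_expect1 P F bh).
apply: filterS (ae_Theta mTheta FTheta) => x Tx; rewrite /h/=.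
have bs := bmeas_pair2 x bshare.
have bs1 : bmeas (fun p => share (p, x) * (1 - c p)).
  by apply: bmeasM => //; exact: bmeasB (bmeas_cst _ _) bc.
transitivity (\int[P]_p ((share (p, x) * (1 - c p)) * (H * clip x))).
  by apply: eq_Rintegral => p _; ring.
rewrite (expectZr P _ bs1) expect_share// clip_id ?T01// XE//.
by field; rewrite lt0r_neq0.
Qed.

Lemma expect_Pi (Y : measurableTypeR R -> R) : bmeas Y ->
  (forall x, Theta x -> Y x = V x) ->
  \int[P]_p (rho p * Pi L H F (tie p) (mu p)) = \int[F]_x Y x.
Proof.
move=> bY YE.
(* Total surplus, less the rent of high-value buyers at price [L], less the surplus lost when
   low-value buyers face [H]. Each term has a mean computed above. *)
pose h w := (H * clip w.2) * a1 w.1 + (1 - clip w.2) * (H * c w.1)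
  - (share w * (1 - c w.1) * (H * clip w.2)
     + (1 - share w) * c w.1 * (H * (1 - clip w.2))).
have b1c := bmeasB bone bcfst.
have b1s := bmeasB bone bshare.
have b1x := bmeasB bone bsnd.
have bHx : bmeas (fun w : measurableTypeR R * measurableTypeR R => H * clip w.2 : R).
  by apply: bmeasM => //; exact: bmeas_cst.
have bH1x : bmeas (fun w : measurableTypeR R * measurableTypeR R => H * (1 - clip w.2) : R).
  by apply: bmeasM => //; exact: bmeas_cst.
have bHc : bmeas (fun w : measurableTypeR R * measurableTypeR R => H * c w.1 : R).
  by apply: bmeasM => //; exact: bmeas_cst.
have bh : bmeas h.
  apply: bmeasB; apply: bmeasD.
  - by apply: bmeasM => //; exact: bw.
  - exact: bmeasM.
  - by apply: bmeasM => //; exact: bmeasM.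
  - by apply: bmeasM => //; exact: bmeasM.
transitivity (\int[P]_p \int[F]_x h (p, x)).
  apply: eq_Rintegral => p _; rewrite PiE -expectZl; last exact: (bmeas_pair1 p bPi).
  apply: eq_Rintegral => x _.
  transitivity (share (p, x) * L * (rho p * type_density F (mu p) (clip x))
    + (1 - share (p, x)) * H * (rho p * high_weight F (mu p) (clip x))).
    by ring.
  by rewrite rho_density rho_high /a1 /h/= /a1; field; rewrite !lt0r_neq0.
rewrite (expect_swap P F bh); apply: eq_expect_ae => //.
  exact: (bmeas_expect1 P F bh).
apply: filterS (ae_Theta mTheta FTheta) => x Tx; rewrite /h/=.
have bs := bmeas_pair2 x bshare.
have bs1 : bmeas (fun p => share (p, x) * (1 - c p)).
  by apply: bmeasM => //; exact: bmeasB (bmeas_cst _ _) bc.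
have bs2 : bmeas (fun p => (1 - share (p, x)) * c p).
  by apply: bmeasM => //; exact: bmeasB (bmeas_cst _ _) bs.
have bHc1 : bmeas (fun p : measurableTypeR R => H * c p).
  by apply: bmeasM => //; exact: bmeas_cst.
have k1 := bmeasM (bmeas_cst _ (H * clip x)) ba1.
have k2 := bmeasM (bmeas_cst _ (1 - clip x)) bHc1.
have k3 := bmeasM bs1 (bmeas_cst _ (H * clip x)).
have k4 := bmeasM bs2 (bmeas_cst _ (H * (1 - clip x))).
rewrite (expectB P (bmeasD k1 k2) (bmeasD k3 k4)) (expectD P k1 k2) (expectD P k3 k4).
rewrite (expectZl P _ ba1) (expectZl P _ bHc1) (expectZl P _ bc).
rewrite (expectZr P _ bs1) (expectZr P _ bs2) expect_a1 expect_argmax.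
rewrite expect_share// expect_not_share// clip_id ?T01// YE//.
by field; rewrite lt0r_neq0.
Qed.

Lemma hull_core (X Y : measurableTypeR R -> R) : bmeas X -> bmeas Y ->
  (forall x, Theta x -> X x = x * (H - V x - (1 - x) * pbar x)) ->
  (forall x, Theta x -> Y x = V x) ->
  hull_section L H F (\int[F]_x X x, \int[F]_x Y x).
Proof.
move=> bX bY XE YE.
(* Triples become functions on ['I_3], the form in which [barycenter] is stated. *)
pose A : set ('I_3 -> R) := fun a => convex_hull (graph L H F)
  (a (@Ordinal 3 0 isT), a (@Ordinal 3 1 isT), a (@Ordinal 3 2 isT)).
have convA a b s : 0 <= s <= 1 -> A a -> A b ->
    A (fun i => s * a i + (1 - s) * b i).
  by move=> s01 Aa Ab; exact: (conv_convex_hull s01 Aa Ab).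
pose f (i : 'I_3) (p : measurableTypeR R) : R :=
  nth 0 [:: mu p; U L H F (tie p) (mu p); Pi L H F (tie p) (mu p)] i.
have bf i : bmeas (f i).
  case: i => [[|[|[|//]]] ?]; rewrite /f/=.
  - exact: bmu.
  - by under eq_fun do rewrite UE; exact: (bmeas_expect2 P F bU).
  - by under eq_fun do rewrite PiE; exact: (bmeas_expect2 P F bPi).
have Af p : A (f ^~ p).
  apply: sub_convex_hull; exists (mu p), (tie p); split; [exact: mu01| |by []].
  by rewrite /tie; case: (pbar (c p) <= p); rewrite ?lexx ?ler01.
have := barycenter convA brho (fun p => ltW (rho_gt0 p)) expect_rho bf Af.
rewrite /A /f/= /hull_section/= -(expect_U bX XE) -(expect_Pi bY YE).
suff -> : \int[P]_p (rho p * mu p) = m by [].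
under eq_Rintegral do rewrite rho_mu.
by rewrite (expectZl P _ ba1) expect_a1 mulr1.
Qed.

End core.

(** * Bayes' rule and envelopes of pricing rules *)

Section bayes.
Context d (T : measurableType d) (R : realType) (P Q : probability T R).
Variables (q : T -> R) (th : R).
Hypothesis mq : measurable_fun setT q.
Hypothesis q01 : forall s, 0 <= q s <= 1.
Hypothesis bayes : forall A, measurable A ->
  th * fine (P A) = th * \int[P]_(s in A) q s + (1 - th) * \int[Q]_(s in A) q s.

Let bq : bmeas q. Proof. exact: bmeas_le mq q01. Qed.

(* Layer cake: [h s] is the mean over [u], uniform on [0, 1], of the indicator
   of [u <= h s]. *)
Let bayes01 (h : T -> R) : measurable_fun setT h -> (forall s, 0 <= h s <= 1) ->
  th * \int[P]_s h s =
  th * \int[P]_s (q s * h s) + (1 - th) * \int[Q]_s (q s * h s).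
Proof.
move=> mh h01; pose U := uniform_prob (@ltr01 R).
pose phi (w : T * measurableTypeR R) : R := (0 < (w.2 : R) <= h w.1)%R%:R.
have bphi : bmeas phi.
  apply: bmeas_bool; apply: measurable_and.
    by apply: measurable_fun_ltr => //; exact: measurable_snd.
  apply: measurable_fun_ler; first exact: measurable_snd.
  by apply: (measurableT_comp mh); exact: measurable_fst.
have hE s : \int[U]_u phi (s, u) = h s.
  have /andP[h0 h1] := h01 s.
  transitivity ((h s - 0) / 1 : R); last by rewrite subr0 divr1.
  exact: (expect_uniform_itv ltr01 (lexx 0) h0 h1).
have bqphi : bmeas (fun w : T * measurableTypeR R => q w.1 * phi w).
  by apply: bmeasM => //; apply: bmeas_comp bq; exact: measurable_fst.
have qE (M : probability T R) :
    \int[M]_s (q s * h s) = \int[U]_u \int[M]_s (q s * phi (s, u)).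
  rewrite -(expect_swap M U bqphi); apply: eq_Rintegral => s _.
  by rewrite /= expectZl ?hE//; exact: bmeas_pair1.
have -> : \int[P]_s h s = \int[U]_u \int[P]_s phi (s, u).
  by rewrite -(expect_swap P U bphi); apply: eq_Rintegral => s _; rewrite hE.
rewrite !qE.
have b1 := bmeas_expect1 P U bphi.
have b2 := bmeas_expect1 P U bqphi.
have b3 := bmeas_expect1 Q U bqphi.
rewrite -(expectZl U th b1) -(expectZl U th b2) -(expectZl U (1 - th) b3).
rewrite -expectD; [|by apply: bmeasM => //; exact: bmeas_cst..].
apply: eq_Rintegral => u _.
pose A := [set s : T | 0 < (u : R) <= h s].
have mA : measurable A.
  have mb : measurable_fun setT (fun s : T => 0 < (u : R) <= h s).
    apply: measurable_and; first exact: measurable_cst.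
    by apply: measurable_fun_ler => //; exact: measurable_cst.
  by have := mb measurableT [set true] I; rewrite setTI.
have phiE s : phi (s, u) = \1_A s.
  rewrite indicE /phi/=; congr ((_ : bool)%:R).
  by apply/idP/idP => [/mem_set//|/set_mem].
have AE (M : probability T R) : \int[M]_(s in A) q s = \int[M]_s (q s * phi (s, u)).
  rewrite Rintegral_mkcond; apply: eq_Rintegral => s _.
  by rewrite patchE phiE indicE; case: (_ \in _); rewrite ?mulr1 ?mulr0.
have := bayes mA; rewrite !AE => <-; congr (_ * _).
by under eq_Rintegral do rewrite phiE; rewrite expect_indic.
Qed.

Lemma bayes_expect (h : T -> R) : bmeas h ->
  th * \int[P]_s h s =
  th * \int[P]_s (q s * h s) + (1 - th) * \int[Q]_s (q s * h s).
Proof.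
move=> bh; have [mh [B hB]] := bh.
(* [h] is rescaled into [0, 1]; the identity is linear in [h], so it follows from those for [k] and
   for the constant 1. The added 1 keeps [C] positive. *)
pose C : R := `|B| + 1; have C0 : 0 < C by rewrite ltr_wpDl.
pose k s := (h s + C) / (2 * C).
have bk : bmeas k.
  by apply: bmeasM; [apply: bmeasD => //|]; exact: bmeas_cst.
have k01 s : 0 <= k s <= 1.
  have := hB s; rewrite ler_norml => /andP[h1 h2].
  have BC : B <= C by rewrite (le_trans (ler_norm _))// lerDl.
  rewrite /k divr_ge0 ?ler_pdivrMr ?mulr_gt0// ?mulr_ge0 ?(ltW C0)//; lra.
have one01 (s : T) : 0 <= (1 : R) <= 1 by rewrite ler01 lexx.
have e1 := bayes01 (proj1 (bmeas_cst T (1 : R))) one01.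
have e2 := bayes01 (proj1 bk) k01.
have bqk := bmeasM bq bk.
have bq1 := bmeasM bq (bmeas_cst T (1 : R)).
have hE (M : probability T R) : \int[M]_s h s = 2 * C * \int[M]_s k s - C.
  rewrite -(expectZl M _ bk) -[X in _ = _ - X](expect_cst M C) -expectB.
  - by apply: eq_Rintegral => s _; rewrite /k; field; rewrite lt0r_neq0.
  - by apply: bmeasM => //; exact: bmeas_cst.
  - exact: bmeas_cst.
have qhE (M : probability T R) : \int[M]_s (q s * h s) =
    2 * C * \int[M]_s (q s * k s) - C * \int[M]_s (q s * 1).
  rewrite -(expectZl M _ bqk) -(expectZl M _ bq1) -expectB.
  - by apply: eq_Rintegral => s _; rewrite /k; field; rewrite lt0r_neq0.
  - by apply: bmeasM => //; exact: bmeas_cst.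
  - by apply: bmeasM => //; exact: bmeas_cst.
rewrite hE !qhE; move: e1 e2; rewrite expect_cst mulr1.
move: (\int[P]_s k s) (\int[P]_s (q s * k s)) (\int[Q]_s (q s * k s)).
move: (\int[P]_s (q s * 1)) (\int[Q]_s (q s * 1)) => x1 x2 x3 x4 x5 e1 e2.
transitivity (2 * C * (th * x3) - C * th); first by ring.
by rewrite e2 [in X in _ - X]e1; ring.
Qed.

End bayes.

(** * Upper envelopes of pricing rules *)

Section envelope.
Context (R : realType) (L H : R).
Hypotheses (hL : 0 < L) (hLH : L < H).
Let H0 : 0 < H. Proof. exact: lt_trans hLH. Qed.

(* Profit, as a function of the type, of a pricing rule that posts the price [L]
   with probability [ij.1] when [v = H] and [ij.2] when [v = L]. *)
Definition rule_profit (ij : R * R) (x : R) : R :=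
  x * (H - (H - L) * ij.1) + (1 - x) * (L * ij.2).

Variable Q : set (R * R).
Hypothesis Q01 : forall ij, Q ij -> 0 <= ij.1 <= 1 /\ 0 <= ij.2 <= 1.
Hypotheses (Q11 : Q (1, 1)) (Q00 : Q (0, 0)).

(** A supremum of affine functions, hence convex. The rules (1, 1) and (0, 0) always post [L] and
    always post [H]; they give the lower bounds [L] and [H * x]. *)
Definition envelope (x : R) : R := sup [set rule_profit ij x | ij in Q].

Lemma rule_profit_slope ij x y : Q ij -> x <= y ->
  0 <= rule_profit ij y - rule_profit ij x <= H * (y - x).
Proof.
move=> /Q01[/andP[i0 i1] /andP[j0 j1]] xy.
have -> : rule_profit ij y - rule_profit ij x =
    (H - (H - L) * ij.1 - L * ij.2) * (y - x) by rewrite /rule_profit; ring.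
have a1 : (H - L) * ij.1 <= H - L by rewrite ler_piMr// subr_ge0 ltW.
have a2 : L * ij.2 <= L by rewrite ler_piMr// ltW.
have a3 : 0 <= (H - L) * ij.1 by rewrite mulr_ge0// subr_ge0 ltW.
have a4 : 0 <= L * ij.2 by rewrite mulr_ge0// ltW.
apply/andP; split; first by rewrite mulr_ge0 ?subr_ge0//; lra.
by rewrite ler_wpM2r ?subr_ge0//; lra.
Qed.

Lemma rule_profit_lipschitz ij x y : Q ij ->
  rule_profit ij y <= rule_profit ij x + H * `|y - x|.
Proof.
move=> Qij; rewrite -lerBlDl; have [xy|/ltW yx] := leP x y.
  by have /andP[_ h] := rule_profit_slope Qij xy; rewrite ger0_norm ?subr_ge0.
have /andP[h _] := rule_profit_slope Qij yx.
apply: le_trans (_ : 0 <= _); first by rewrite -oppr_ge0 opprB.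
by rewrite mulr_ge0// ltW.
Qed.

Lemma rule_profit_ub x : has_ubound [set rule_profit ij x | ij in Q].
Proof.
exists (L + H * `|x|) => _ [ij Qij <-].
have := rule_profit_lipschitz 0 x Qij; rewrite subr0 => /le_trans; apply.
rewrite lerD2r /rule_profit mul0r add0r subr0 mul1r.
by have [_ /andP[_ j1]] := Q01 Qij; rewrite ler_piMr// ltW.
Qed.

Lemma rule_profit_le ij x : Q ij -> rule_profit ij x <= envelope x.
Proof. by move=> Qij; apply: ub_le_sup; [exact: rule_profit_ub|exists ij]. Qed.

Lemma envelope_le x k : (forall ij, Q ij -> rule_profit ij x <= k) ->
  envelope x <= k.
Proof.
move=> h; apply: ge_sup; first by exists (rule_profit (1, 1) x), (1, 1).
by move=> _ [ij Qij <-]; exact: h.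
Qed.

Lemma envelope_lipschitz x y : envelope y <= envelope x + H * `|y - x|.
Proof.
apply: envelope_le => ij Qij; apply: (le_trans (rule_profit_lipschitz x y Qij)).
by rewrite lerD2r rule_profit_le.
Qed.

Lemma envelope_continuous : continuous envelope.
Proof.
move=> x; apply/cvgrPdist_le => e e0; near=> y.
have xy : `|x - y| <= e / H.
  by near: y; apply: cvgr_dist_le; [exact: cvg_id|rewrite divr_gt0].
have hxy : H * `|x - y| <= e by rewrite mulrC -ler_pdivlMr.
rewrite ler_norml; apply/andP; split.
  by have := envelope_lipschitz x y; rewrite distrC => h; lra.
by have := envelope_lipschitz y x => h; lra.
Unshelve. all: by end_near. Qed.

Lemma envelope_geL x : L <= envelope x.
Proof.
apply: le_trans (rule_profit_le x Q11).
by rewrite /rule_profit/= le_eqVlt; apply/orP; left; apply/eqP; ring.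
Qed.

Lemma envelope_geH x : H * x <= envelope x.
Proof.
apply: le_trans (rule_profit_le x Q00).
by rewrite /rule_profit/= le_eqVlt; apply/orP; left; apply/eqP; ring.
Qed.

Lemma envelope0 : envelope 0 = L.
Proof.
apply/eqP; rewrite eq_le envelope_geL andbT; apply: envelope_le => ij /Q01[_ /andP[_ j1]].
by rewrite /rule_profit mul0r add0r subr0 mul1r ler_piMr// ltW.
Qed.

Lemma envelope1 : envelope 1 = H.
Proof.
apply/eqP; rewrite eq_le -{2}[H]mulr1 envelope_geH andbT.
apply: envelope_le => ij /Q01[/andP[i0 _] _].
by rewrite /rule_profit subrr mul0r addr0 mul1r gerBl mulr_ge0// subr_ge0 ltW.
Qed.

End envelope.

(** * Interim payoffs in equilibrium *)

Section kernel_probability.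
Context d d' (X : measurableType d) (Y : measurableType d') (R : realType).
Variable k : R.-pker X ~> Y.

(** Gives each law of the kernel the structure of a probability, so that the lemmas on expectations
    apply to posted prices. *)
Definition kernel_prob (x : X) : set Y -> \bar R := k x.

HB.instance Definition _ x := Measure.on (kernel_prob x).
HB.instance Definition _ x :=
  Measure_isProbability.Build _ _ _ (kernel_prob x) (prob_kernel x).

End kernel_probability.

Section equilibrium.
Variables (R : realType) (L H : R).
Hypotheses (hL : 0 < L) (hLH : L < H).
Variables (Theta : set (measurableTypeR R)) (M : menu R) (a : assessment R).
Hypothesis Theta01 : Theta `<=` `[0, 1]%classic.
Hypothesis buyerP : buyer_rational L H a.
Hypothesis bayesP : bayes_consistent Theta M a.
Hypothesis pricingP : pricing_rational Theta M a.
Let H0 : 0 < H. Proof. exact: lt_trans hLH. Qed.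
Let HL : 0 < H - L. Proof. by rewrite subr_gt0. Qed.

Lemma buy_lt v p : p < val_of L H v -> buy a v p = 1.
Proof.
move=> pv; have [_ b01 bo] := buyerP; have /andP[_ b1] := b01 v p.
have o1 : 0 <= (1 : R) <= 1 by rewrite ler01 lexx.
have := bo v p 1 o1; rewrite /buyer_gain ler_pM2r ?subr_gt0// => b1'.
by apply/eqP; rewrite eq_le b1.
Qed.

Lemma buy_gt v p : val_of L H v < p -> buy a v p = 0.
Proof.
move=> pv; have [_ b01 bo] := buyerP; have /andP[b0 _] := b01 v p.
have o1 : 0 <= (0 : R) <= 1 by rewrite ler01 lexx.
have := bo v p 0 o1; rewrite /buyer_gain mul0r nmulr_lge0 ?subr_lt0// => b1'.
by apply/eqP; rewrite eq_le b0 b1'.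
Qed.

Let opt q p := forall p' : R, revenue a q p' <= revenue a q p.

(** A buyer of value [L] may refuse the price [L], so the bound comes from prices just below [L],
    which both values accept: if the revenue were less than [L], the midpoint of the two would be a
    better price. *)
Lemma opt_geL q p : opt q p -> L <= revenue a q p.
Proof.
move=> op; rewrite leNgt; apply/negP => rL.
pose p' := (revenue a q p + L) / 2.
have [pr pL] : revenue a q p < p' /\ p' < L by rewrite /p'; split; lra.
have := op p'; rewrite {1}/revenue /seller_gain !buy_lt//=; last exact: lt_trans pL hLH.
by rewrite !mul1r -mulrDl addrC subrK mul1r leNgt pr.
Qed.

Lemma opt_geH q p : 0 <= q <= 1 -> opt q p -> q * H <= revenue a q p.
Proof.
move=> q01 op; have rL := opt_geL op; have /andP[q0 q1] := q01.
have r0 : 0 <= revenue a q p by exact: le_trans (ltW hL) rL.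
move: q0; rewrite le_eqVlt => /predU1P[q00|{}q0]; first by rewrite -{1}q00 mul0r.
rewrite leNgt; apply/negP => rH.
(* The price at which a sale to the high value alone earns [revenue a q p]; a price between [x] and
   [H] earns more. *)
pose x := revenue a q p / q.
have xH : x < H by rewrite /x ltr_pdivrMr// mulrC.
have x0 : 0 <= x by rewrite divr_ge0// ltW.
pose p' := (x + H) / 2.
have [pr pH] : x < p' /\ p' < H by rewrite /p'; split; lra.
have p'0 : 0 <= p' by exact: le_trans (ltW pr).
have := op p'; rewrite {1}/revenue /seller_gain buy_lt// mul1r.
have [_ b01 _] := buyerP; have /andP[b0 _] := b01 false p'.
apply/negP; rewrite -ltNge; apply: lt_le_trans (_ : q * p' <= _).
  by rewrite mulrC -ltr_pdivrMr.
by rewrite lerDl; apply: mulr_ge0; [rewrite subr_ge0|exact: mulr_ge0].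
Qed.

(** Below [L] both values buy, for less than [L]; strictly between [L] and [H] only the high value
    buys, for less than [q * H] or, if [q = 0], for nothing; above [H] there is no sale. *)
Lemma opt_price q p : 0 <= q <= 1 -> opt q p -> p = L \/ p = H.
Proof.
move=> q01 op; have rL := opt_geL op; have rH := opt_geH q01 op.
have /andP[q0 q1] := q01.
have [pL|pL|->] := ltgtP p L; [|right|by left].
  move: rL; rewrite /revenue /seller_gain !buy_lt//=; last exact: lt_trans pL hLH.
  by rewrite !mul1r -mulrDl addrC subrK mul1r leNgt pL.
have bf : buy a false p = 0 by exact: buy_gt.
have [pH|pH|//] := ltgtP p H.
  move: rL rH; rewrite /revenue /seller_gain bf buy_lt// mul1r mul0r mulr0 addr0.
  move: q0; rewrite le_eqVlt => /predU1P[<-|{}q0].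
    by rewrite !mul0r leNgt hL.
  by move=> _; rewrite ler_pM2l// leNgt pH.
move: rL; rewrite /revenue /seller_gain bf buy_gt// !mul0r !mulr0 addr0.
by rewrite leNgt hL.
Qed.

(** Since [q * H <= L < H], the value [L] has positive probability, and the revenue reaches [L] only
    if that buyer accepts surely. *)
Lemma opt_L q : 0 <= q <= 1 -> opt q L -> buy a false L = 1 /\ q * H <= L.
Proof.
move=> q01 op; have rL := opt_geL op; have rH := opt_geH q01 op.
have /andP[q0 q1] := q01.
have [_ b01 _] := buyerP; have /andP[b0 b1] := b01 false L.
have rE : revenue a q L = q * L + (1 - q) * (buy a false L * L).
  by rewrite /revenue /seller_gain buy_lt ?mul1r.
have bL : buy a false L * L <= L by rewrite ler_piMl// ltW.
have r_le : revenue a q L <= L.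
  rewrite rE -[leRHS](_ : q * L + (1 - q) * L = L); last by ring.
  by rewrite lerD2l ler_wpM2l// subr_ge0.
have qH : q * H <= L by exact: le_trans r_le.
have q1' : q < 1.
  rewrite lt_neqAle q1 andbT; apply/eqP => qE; move: qH.
  by rewrite qE mul1r leNgt hLH.
split=> //; apply/eqP; rewrite eq_le b1/=.
move: rL; rewrite rE -[X in X <= _](_ : q * L + (1 - q) * L = L); last by ring.
rewrite lerD2l ler_pM2l ?subr_gt0// -[X in X <= _]mul1r ler_pM2r//.
Qed.

Lemma opt_H q : 0 <= q <= 1 -> opt q H -> L <= q * H.
Proof.
move=> q01 op; have rL := opt_geL op; have /andP[q0 q1] := q01.
have [_ b01 _] := buyerP; have /andP[b0 b1] := b01 true H.
apply: (le_trans rL); rewrite /revenue /seller_gain (@buy_gt false)//.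
by rewrite mul0r mulr0 addr0; apply: ler_wpM2l => //; rewrite ler_piMl// ltW.
Qed.

(** Optimality of the posted price forces the indifferent buyer to accept, so all gains are
    functions of the event [p == L] alone. *)
Lemma opt_gains q p : 0 <= q <= 1 -> opt q p ->
  [/\ seller_gain a true p = H - (H - L) * (p == L)%:R,
      seller_gain a false p = L * (p == L)%:R,
      buyer_gain L H a true p = (H - L) * (p == L)%:R &
      buyer_gain L H a false p = 0].
Proof.
move=> q01 op; rewrite /seller_gain /buyer_gain.
have [pL|pH] := opt_price q01 op; subst p.
  have [bL _] := opt_L q01 op.
  by rewrite bL buy_lt// eqxx !mulr1 !mul1r subrr/= opprB addrCA subrr addr0.
have b1 : H * buy a true H = H.
  have rH := opt_geH q01 op; have q0 : 0 < q.
    by rewrite -(pmulr_lgt0 _ H0) (lt_le_trans hL)// opt_H.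
  have [_ b01 _] := buyerP; have /andP[_ b1] := b01 true H.
  move: rH; rewrite /revenue /seller_gain (@buy_gt false)//.
  rewrite mul0r mulr0 addr0 ler_pM2l// -[X in X <= _]mul1r ler_pM2r// => b1'.
  by rewrite (_ : buy a true H = 1) ?mulr1//; apply/eqP; rewrite eq_le b1.
rewrite (@buy_gt false)// gt_eqF//= !mulr0 !mul0r subr0 subrr mulr0.
by rewrite mulrC b1.
Qed.

Section fixed.
Variables (th : R) (I : signal R).
Hypotheses (Tth : Theta th) (MI : M I).
Let S := sig_space I.
Local Notation q := (belief a th (I := I)).
Local Notation K s := (kernel_prob (price a th I) s).

Let th01 : 0 <= th <= 1.
Proof. by have := Theta01 Tth; rewrite /= in_itv. Qed.

Let q01 s : 0 <= q s <= 1.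
Proof. by have [_ + _] := bayesP Tth MI; exact. Qed.

Let optP s : {ae K s, forall p : measurableTypeR R, opt (q s) p}.
Proof. exact: (pricingP s Tth MI). Qed.

Definition low_prob (s : S) : R := \int[K s]_p (p == L)%:R.

Let beq : bmeas (fun p : measurableTypeR R => ((p : R) == L)%:R : R).
Proof. by apply: bmeas_bool; exact: measurable_fun_eqr. Qed.

Lemma low_prob01 s : 0 <= low_prob s <= 1.
Proof.
by apply: expect_itv => // p; case: (_ == _); rewrite ?lexx ?ler01.
Qed.

Lemma measurable_low_prob : measurable_fun setT low_prob.
Proof.
have E s : low_prob s = fine (price a th I s [set L]).
  rewrite /low_prob -(expect_indic (K s) (measurable_set1 (L : measurableTypeR R))).
  by apply: eq_Rintegral => p _; rewrite indicE in_set1.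
rewrite (_ : low_prob = fun s => fine (price a th I s [set L])); last exact/funext.
apply: (measurableT_comp (fine_measurable measurableT)).
exact: measurable_kernel.
Qed.

Lemma bmeas_low_prob : bmeas low_prob.
Proof. exact: bmeas_le measurable_low_prob low_prob01. Qed.

Let msell v : measurable_fun setT (seller_gain a v : measurableTypeR R -> R).
Proof. by have [mb _ _] := buyerP; apply: measurable_funM. Qed.

Let mbuy v : measurable_fun setT (buyer_gain L H a v : measurableTypeR R -> R).
Proof.
have [mb _ _] := buyerP; apply: measurable_funM => //.
by apply: measurable_funB => //; exact: measurable_cst.
Qed.

Let gain_mean (g : R -> R) (x y : R) s :
  measurable_fun setT (g : measurableTypeR R -> R) ->
  (forall p, opt (q s) p -> g p = x + y * (p == L)%:R) ->
  \int[price a th I s]_p g p = x + y * low_prob s.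
Proof.
move=> mg gE; have by_ := bmeasM (bmeas_cst _ y) beq.
have bxy := bmeasD (bmeas_cst _ x) by_.
transitivity (\int[K s]_p (x + y * (p == L)%:R)).
  apply: (@eq_Rintegral_ae _ _ _ (K s)) => //; first by case: bxy.
  by apply: (ae_sub (P := K s) (optP s)) => p; exact: gE.
by rewrite (expectD (K s) (bmeas_cst _ x) by_) expect_cst (expectZl (K s) _ beq).
Qed.

Definition low_given v := \int[sig_law I v]_s low_prob s.

Lemma low_given01 v : 0 <= low_given v <= 1.
Proof. by apply: expect_itv; [exact: bmeas_low_prob|exact: low_prob01]. Qed.

Let given_mean v (g : R -> R) (x y : R) :
  measurable_fun setT (g : measurableTypeR R -> R) ->
  (forall s p, opt (q s) p -> g p = x + y * (p == L)%:R) ->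
  \int[sig_law I v]_s \int[price a th I s]_p g p = x + y * low_given v.
Proof.
move=> mg gE; rewrite /low_given.
have by_ := bmeasM (bmeas_cst _ y) bmeas_low_prob.
rewrite -(expectZl _ _ bmeas_low_prob) -[X in _ = X + _](expect_cst (sig_law I v)).
rewrite -(expectD _ (bmeas_cst _ x) by_).
by apply: eq_Rintegral => s _; apply: gain_mean => //; exact: gE.
Qed.

Lemma interim_seller : interim a (seller_gain a) th I =
  rule_profit L H (low_given true, low_given false) th.
Proof.
rewrite /interim /rule_profit/=.
rewrite (@given_mean true _ H (- (H - L))) ?(@given_mean false _ 0 L)//.
- by rewrite mulNr add0r.
- by move=> s p /(opt_gains (q01 s))[_ -> _ _]; rewrite add0r.
- by move=> s p /(opt_gains (q01 s))[-> _ _ _]; rewrite mulNr.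
Qed.

Lemma interim_buyer : interim a (buyer_gain L H a) th I =
  th * ((H - L) * low_given true).
Proof.
rewrite /interim.
rewrite (@given_mean true _ 0 (H - L)) ?(@given_mean false _ 0 0)//.
- by rewrite mul0r !add0r mulr0 addr0.
- by move=> s p /(opt_gains (q01 s))[_ _ _ ->]; rewrite add0r mul0r.
- by move=> s p /(opt_gains (q01 s))[_ _ -> _]; rewrite add0r.
Qed.

(** The sign of [L - q s * H] tells which price is optimal; when it is nonzero, [low_prob s] is the
    corresponding extreme value 0 or 1. *)
Let low_prob_opt (rho : S -> R) s : 0 <= rho s <= 1 ->
  0 <= (L - q s * H) * (low_prob s - rho s).
Proof.
move=> /andP[r0 r1].
have [lt|gt|->] := ltgtP (q s * H) L; last by rewrite subrr mul0r.
- suff -> : low_prob s = 1 by rewrite mulr_ge0 ?subr_ge0// ltW.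
  rewrite /low_prob -[RHS](expect_cst (K s)); apply: eq_expect_ae => //.
    exact: bmeas_cst.
  apply: (ae_sub (P := K s) (optP s)) => p op.
  have [->|pH] := opt_price (q01 s) op; first by rewrite eqxx.
  by move: op; rewrite pH => /(opt_H (q01 s)); rewrite leNgt lt.
- suff -> : low_prob s = 0 by rewrite sub0r mulr_le0// ?oppr_le0// subr_le0 ltW.
  rewrite /low_prob -[RHS](expect_cst (K s)); apply: eq_expect_ae => //.
    exact: bmeas_cst.
  apply: (ae_sub (P := K s) (optP s)) => p op.
  have [pL|->] := opt_price (q01 s) op; last by rewrite gt_eqF.
  by move: op; rewrite pL => /(opt_L (q01 s))[_]; rewrite leNgt gt.
Qed.

(* Against any pricing rule [rho], the gain of the optimal rule is the mean of
   [(L - q H) (low_prob - rho) >= 0] under the unconditional law of [s]. *)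
Lemma interim_ge (rho : S -> R) : measurable_fun setT rho ->
  (forall s, 0 <= rho s <= 1) ->
  rule_profit L H (\int[sig_law I true]_s rho s, \int[sig_law I false]_s rho s) th
  <= interim a (seller_gain a) th I.
Proof.
move=> mr r01; rewrite interim_seller -subr_ge0 /rule_profit/= /low_given.
have [mq _ bayes] := bayesP Tth MI.
have br := bmeas_le mr r01; have bl := bmeas_low_prob.
have bh := bmeasB bl br; have bq := bmeas_le mq q01.
have bqh := bmeasM bq bh.
have := bayes_expect mq q01 bayes bh.
have hE v : \int[sig_law I v]_s (low_prob s - rho s) =
    \int[sig_law I v]_s low_prob s - \int[sig_law I v]_s rho s.
  by rewrite expectB.
have gap v : 0 <= L * \int[sig_law I v]_s (low_prob s - rho s)
    - H * \int[sig_law I v]_s (q s * (low_prob s - rho s)).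
  have bL := bmeasM (bmeas_cst _ L) bh; have bH := bmeasM (bmeas_cst _ H) bqh.
  rewrite -(expectZl _ L bh) -(expectZl _ H bqh) -(expectB _ bL bH).
  apply: expect_ge0 => s; have := low_prob_opt (r01 s).
  by rewrite (_ : _ * _ = L * (low_prob s - rho s) - H * (q s * (low_prob s - rho s)))//; ring.
have := gap true; have := gap false; rewrite !hE.
move: (\int[sig_law I true]_s (q s * _)) (\int[sig_law I false]_s (q s * _)) => x1 x2.
move: (\int[sig_law I true]_s low_prob s) (\int[sig_law I false]_s low_prob s) => l1 l2.
move: (\int[sig_law I true]_s rho s) (\int[sig_law I false]_s rho s) => r1 r2 g2 g1 e.
have /andP[t0 t1] := th01.
have t1' : 0 <= 1 - th by rewrite subr_ge0.
have := addr_ge0 (mulr_ge0 t0 g1) (mulr_ge0 t1' g2); have := congr1 ( *%R H) e.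
lra.
Qed.

End fixed.

End equilibrium.

(** * Equilibrium outcomes lie in the hull *)

Section implementable_hull.
Variables (R : realType) (L H : R).
Hypotheses (hL : 0 < L) (hLH : L < H).
Variables (Theta : set (measurableTypeR R)) (F : probability (measurableTypeR R) R).
Variables (M : menu R) (a : assessment R).
Hypotheses (mTheta : measurable Theta) (Theta01 : Theta `<=` `[0, 1]%classic).
Hypotheses (FTheta : F Theta = 1%:E) (hmu0 : 0 < prior_mean F < 1).
Hypothesis equilP : equilibrium L H Theta M a.
Let H0 : 0 < H. Proof. exact: lt_trans hLH. Qed.
Let HL : 0 < H - L. Proof. by rewrite subr_gt0. Qed.

Let buyerP : buyer_rational L H a. Proof. by case: equilP. Qed.
Let bayesP : bayes_consistent Theta M a. Proof. by case: equilP. Qed.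
Let pricingP : pricing_rational Theta M a. Proof. by case: equilP. Qed.
Let choiceP : choice_rational Theta M a. Proof. by case: equilP. Qed.
Let measP : choice_measurable L H Theta a. Proof. by case: equilP. Qed.

Let T01 x : Theta x -> 0 <= x <= 1.
Proof. by move=> /Theta01; rewrite /= in_itv. Qed.

Let pq th w := (low_given L a th (Defs.choice a th w) true,
                low_given L a th (Defs.choice a th w) false).

(** The rules used by some type under his chosen signal, together with the two constant rules, which
    are open to every type after any signal. *)
Let Q : set (R * R) := [set ij | ij = (1, 1) \/ ij = (0, 0) \/
  exists th w, [/\ Theta th, 0 <= w <= 1 & ij = pq th w]].

Let Q01 ij : Q ij -> 0 <= ij.1 <= 1 /\ 0 <= ij.2 <= 1.
Proof.
move=> [->|[->|[th [w [_ _ ->]]]]]; rewrite /= ?lexx ?ler01//.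
by split; exact: low_given01.
Qed.

Let Q11 : Q (1, 1). Proof. by left. Qed.
Let Q00 : Q (0, 0). Proof. by right; left. Qed.
Let Qpq th w : Theta th -> 0 <= w <= 1 -> Q (pq th w).
Proof. by move=> Tth w01; right; right; exists th, w. Qed.

Let V := envelope L H Q.

Let sellerE th w : Theta th -> 0 <= w <= 1 ->
  interim a (seller_gain a) th (Defs.choice a th w) = rule_profit L H (pq th w) th.
Proof.
move=> Tth w01; have [Mc _] := choiceP Tth w01.
exact: (interim_seller hL hLH buyerP bayesP pricingP Tth Mc).
Qed.

(** Type [th] can choose the signal of [th'] and price as [th'] does; by [interim_ge] his optimal
    pricing there earns no less, and by [choice_rational] his own signal no less again. So no rule
    in [Q] beats his own. *)
Let sellerV th w : Theta th -> 0 <= w <= 1 ->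
  interim a (seller_gain a) th (Defs.choice a th w) = V th.
Proof.
move=> Tth w01; have [Mc best] := choiceP Tth w01.
apply/eqP; rewrite eq_le {1}sellerE// rule_profit_le//=; last exact: Qpq.
have dev I : M I -> forall rho : sig_space I -> R, measurable_fun setT rho ->
    (forall s, 0 <= rho s <= 1) ->
    rule_profit L H (\int[sig_law I true]_s rho s, \int[sig_law I false]_s rho s) th
    <= interim a (seller_gain a) th (Defs.choice a th w).
  move=> MI rho mr r01; apply: le_trans (best _ MI).
  exact: (interim_ge hL hLH Theta01 buyerP bayesP pricingP Tth MI mr r01).
have cst01 (k : R) : 0 <= k <= 1 ->
    rule_profit L H (k, k) th <= interim a (seller_gain a) th (Defs.choice a th w).
  move=> k01; have := dev _ Mc (fun=> k) (proj1 (bmeas_cst _ k)) (fun=> k01).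
  by rewrite !expect_cst.
apply: envelope_le => // ij [->|[->|[th' [w' [Tth' w01' ->]]]]].
- by apply: cst01; rewrite lexx ler01.
- by apply: cst01; rewrite lexx ler01.
have [Mc' _] := choiceP Tth' w01'.
have := dev _ Mc' _ (@measurable_low_prob R L a th' (Defs.choice a th' w')).
by apply; exact: low_prob01.
Qed.

Let buyerE th w : Theta th -> 0 <= w <= 1 ->
  interim a (buyer_gain L H a) th (Defs.choice a th w) = th * ((H - L) * (pq th w).1).
Proof.
move=> Tth w01; have [Mc _] := choiceP Tth w01.
exact: (interim_buyer hL hLH buyerP bayesP pricingP Tth Mc).
Qed.

Let D : set (measurableTypeR R * measurableTypeR R) := Theta `*` `[0, 1]%classic.

Let DP x : D x -> Theta x.1 /\ 0 <= (x.2 : R) <= 1.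
Proof. by move=> [? /=]; rewrite in_itv. Qed.

Let gain (g : bool -> R -> R) (x : measurableTypeR R * measurableTypeR R) : R :=
  ((fun x : measurableTypeR R * measurableTypeR R =>
     interim a g x.1 (Defs.choice a x.1 x.2)) \_ D) x.

Let bgain g : g = seller_gain a \/ g = buyer_gain L H a -> bmeas (gain g).
Proof.
move=> gE; split.
  have mD : measurable D by apply: measurableX => //; exact: measurable_itv.
  by apply/(measurable_restrictT _ mD); exact: measP.
exists H => x; rewrite /gain patchE; case: ifPn => [/set_mem/DP[T1 w1]|_]; last first.
  by rewrite normr0 ltW.
have /andP[t0 t1] := T01 T1; case: gE => ->.
  have /andP[i0 i1] := T01 T1.
  rewrite sellerV// ger0_norm ?(le_trans (ltW hL))// ?envelope_geL//.
  rewrite -(envelope1 hL hLH Q01 Q11 Q00).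
  apply: envelope_le => // ij Qij; apply: le_trans (rule_profit_le hL hLH Q01 1 Qij).
  by rewrite -subr_ge0; have /andP[] := rule_profit_slope hL hLH Q01 Qij t1.
rewrite buyerE//; have [/andP[p0 p1] _] := Q01 (Qpq T1 w1).
rewrite ger0_norm ?mulr_ge0 ?(ltW HL)//.
apply: (@le_trans _ _ (H - L)); last by rewrite gerBl ltW.
by rewrite -[leRHS]mul1r ler_pM ?mulr_ge0 ?(ltW HL)// ler_piMr ?(ltW HL).
Qed.

Local Notation unif := (uniform_prob (@ltr01 R)).

Let ex_anteE g : g = seller_gain a \/ g = buyer_gain L H a ->
  ex_ante Theta F a g = \int[F]_x \int[unif]_w gain g (x, w).
Proof.
move=> gE; rewrite /ex_ante Rintegral_mkcond; apply: eq_Rintegral => x _.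
rewrite patchE; case: ifPn => xT.
  rewrite Rintegral_mkcond; apply: eq_Rintegral => w _.
  rewrite patchE /gain patchE.
  by rewrite (_ : ((x, w) \in D) = (w \in `[0, 1]%classic))//= in_setX xT.
rewrite -[LHS](expect_cst unif); apply: eq_Rintegral => w _.
rewrite /gain patchE.
by rewrite (_ : ((x, w) \in D) = false)// in_setX (negbTE xT).
Qed.

Let gain_in g th w : Theta th -> 0 <= w <= 1 ->
  gain g (th, w) = interim a g th (Defs.choice a th w).
Proof.
by move=> Tth w01; rewrite /gain patchE mem_set//; split => //=; rewrite in_itv.
Qed.

Let ae_unif : {ae unif, forall w : measurableTypeR R, 0 <= (w : R) <= 1}.
Proof. by apply: (ae_sub (ae_uniform ltr01)) => w /andP[/ltW -> ->]. Qed.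

Let b th := \int[unif]_w gain (buyer_gain L H a) (th, w).

Let bb : bmeas (b : measurableTypeR R -> R).
Proof. by apply: (bmeas_expect2 F unif); apply: bgain; right. Qed.

Let V1 : V 1 = H. Proof. exact: envelope1. Qed.
Let V0 : V 0 = L. Proof. exact: envelope0. Qed.
Let VgeL x : L <= V x. Proof. exact: envelope_geL. Qed.
Let VgeH x : H * x <= V x. Proof. exact: envelope_geH. Qed.

Let mV : measurable_fun setT (V : measurableTypeR R -> R).
Proof.
by apply: continuous_measurable_fun; exact: (envelope_continuous hL hLH Q01).
Qed.

(** The subgradient solved from b(x) = x (H - V(x) - (1 - x) pbar(x)) for x in (0, 1). At 1 and 0
    that equation leaves it free, and the slopes [H] and 0 of the lower bounds [H * x] and [L] are
    taken. *)
Let pbar (x : measurableTypeR R) : R :=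
  if (x \in Theta) && (0 < (x : R) < 1) then (H - b x / x - V x) / (1 - x)
  else if (x : R) == 1 then H else 0.

Let mpbar : measurable_fun setT pbar.
Proof.
apply: measurable_fun_ifT; last 1 first.
- apply: measurable_fun_ifT; [exact: measurable_fun_eqr|exact: measurable_cst..].
- apply: measurable_and.
    rewrite (_ : (fun _ => _) = fun x => (x \in Theta)%:R == (1 : R)).
      by apply: measurable_fun_eqr => //; case: (bmeas_mem mTheta).
    by apply/funext => x; case: (x \in Theta); rewrite ?eqxx// eq_sym oner_eq0.
  by apply: measurable_and; exact: measurable_fun_ltr.
apply: measurable_fun_div; last exact: measurable_funB.
apply: measurable_funB => //; apply: measurable_funB => //.
by apply: measurable_fun_div => //; case: bb.
Qed.

(* Averages over the seller's randomization the support line of [V] at [th]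
   given by the profit of his pricing rule. *)
Let support th y : Theta th -> 0 < th < 1 -> 0 <= y <= 1 ->
  V th + (H - b th / th - V th) / (1 - th) * (y - th) <= V y.
Proof.
move=> Tth /andP[t0 t1] y01.
have bg := bmeas_pair1 th (bgain (or_intror erefl)).
have t1' : 0 < 1 - th by rewrite subr_gt0.
(* The line is affine in [b th], so it suffices to prove the bound for each outcome [w] of the
   randomization and average. *)
pose k1 := - (y - th) / (th * (1 - th)).
pose k0 := V th + (H - V th) / (1 - th) * (y - th).
have -> : V th + (H - b th / th - V th) / (1 - th) * (y - th) = k0 + k1 * b th.
  by rewrite /k0 /k1; field; rewrite !lt0r_neq0.
have bk := bmeasM (bmeas_cst _ k1) bg.
rewrite /b -(expectZl _ k1 bg) -[X in X + _](expect_cst unif) -(expectD _ (bmeas_cst _ k0) bk).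
rewrite -[leRHS](expect_cst unif).
apply: le_expect_ae; [exact: bmeasD (bmeas_cst _ k0) bk|exact: bmeas_cst|].
apply: (ae_sub ae_unif) => w w01.
rewrite gain_in// buyerE//.
(* For a fixed [w] the line is the profit of the rule [pq th w] as a function of the type. *)
apply: le_trans (rule_profit_le hL hLH Q01 y (Qpq Tth w01)).
have := sellerV Tth w01; rewrite sellerE//.
rewrite /k0 /k1 /rule_profit; move: (pq th w) => [i j] /= <-.
rewrite le_eqVlt; apply/orP; left; apply/eqP.
by field; rewrite !lt0r_neq0.
Qed.

Let pbarP x y : Theta x -> 0 <= y <= 1 -> V x + pbar x * (y - x) <= V y.
Proof.
move=> Tx y01; have /andP[x0 x1] := T01 Tx; rewrite /pbar mem_set//=.
case: ifPn => [x01|]; first exact: support.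
rewrite negb_and -!leNgt => xE.
case: eqVneq => [->|xn1].
  rewrite V1 mulrBr mulr1 addrCA subrr addr0.
  exact: VgeH.
have -> : x = 0.
  apply/eqP; rewrite eq_le x0 andbT.
  by case/orP: xE => // x1'; rewrite eq_le x1 x1' in xn1.
by rewrite mul0r addr0 V0 VgeL.
Qed.

Let pbar0H x : Theta x -> 0 <= pbar x <= H.
Proof.
move=> Tx; have o0 : 0 <= (0 : R) <= 1 by rewrite lexx ler01.
have o1 : 0 <= (1 : R) <= 1 by rewrite lexx ler01.
have := pbarP Tx o0; have := pbarP Tx o1.
rewrite /pbar mem_set//=; case: ifPn => [/andP[x0 x1]|_] ; last first.
  by case: ifP; rewrite ?lexx ?(ltW H0).
rewrite V1 V0.
have VL := VgeL x; have VH := VgeH x.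
move: ((H - b x / x - V x) / (1 - x)) (V x) VL VH => p v VL VH h1 h0.
have x1' : 0 < 1 - x by rewrite subr_gt0.
apply/andP; split.
  by rewrite -(pmulr_lge0 _ x0); lra.
by rewrite -(ler_pM2r x1'); lra.
Qed.

(** Inside (0, 1) this is the definition of [pbar]. At 1, [V 1 = H] forces the probability of the
    price [L] given [v = H] to be 0; at 0 the surplus has the factor [x]. *)
Let XE x : Theta x -> b x = x * (H - V x - (1 - x) * pbar x).
Proof.
move=> Tx; have /andP[x0 x1] := T01 Tx; rewrite /pbar mem_set//=.
have bg := bmeas_pair1 x (bgain (or_intror erefl)).
case: ifPn => [/andP[x0' x1']|].
  by field; rewrite !lt0r_neq0// subr_gt0.
rewrite negb_and -!leNgt => xE.
have b0 : (forall w, 0 <= w <= 1 -> x * ((H - L) * (pq x w).1) = 0) -> b x = 0.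
  move=> h; rewrite /b -[RHS](expect_cst unif); apply: eq_expect_ae => //.
    exact: bmeas_cst.
  by apply: (ae_sub ae_unif) => w w01; rewrite gain_in// buyerE// h.
case: eqVneq => [x1E|xn1].
  rewrite {2 3 4}x1E V1 !subrr mul0r subr0 mulr0.
  apply: b0 => w w01; have := sellerV Tx w01; rewrite sellerE// x1E.
  rewrite V1 /rule_profit subrr mul0r addr0 !mul1r.
  by move=> e; lra.
have x00 : x = 0.
  apply/eqP; rewrite eq_le x0 andbT.
  by case/orP: xE => // x1'; rewrite eq_le x1 x1' in xn1.
rewrite b0; first by rewrite {1}x00 mul0r.
by move=> w _; rewrite {1}x00 mul0r.
Qed.

Lemma equilibrium_hull : hull_section L H F
  (ex_ante Theta F a (buyer_gain L H a), ex_ante Theta F a (seller_gain a)).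
Proof.
have Vc : continuous V := envelope_continuous hL hLH Q01 Q11.
have [c cP] := argmax_exists Vc.
rewrite !ex_anteE; [|by left|by right].
have bY : bmeas (fun x : measurableTypeR R => \int[unif]_w gain (seller_gain a) (x, w)).
  by apply: (bmeas_expect2 F unif); apply: bgain; left.
apply: (@hull_core R L H F hL hLH hmu0 Theta mTheta Theta01 FTheta V _ _ _ _
  pbar mpbar pbar0H pbarP c _ _ b _ bb bY XE).
- by move=> x _; exact: VgeL.
- by move=> x _; exact: VgeH.
- exact: V0.
- exact: V1.
- by move=> p; case: (cP p).
- by move=> p x x01; case: (cP p) => _; exact.
move=> x Tx; rewrite -[RHS](expect_cst unif); apply: eq_expect_ae.
- by apply: bmeas_pair1; apply: bgain; left.
- exact: bmeas_cst.
- by apply: (ae_sub ae_unif) => w w01; rewrite gain_in// sellerV.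
Qed.

End implementable_hull.

(** * Finite signals *)

Section finite_mixture.
Context d (T : measurableType d) (R : realType) (n : nat).
Variables (w : nat -> R) (x : nat -> T).
Hypotheses (w0 : forall i, 0 <= w i) (w1 : \sum_(i < n) w i = 1).

Definition mixture : set T -> \bar R :=
  msum (fun i => mscale (NngNum (w0 i)) (@dirac _ T (x i) R)) n.

HB.instance Definition _ := Measure.on mixture.

Let mixture_setT : mixture setT = 1%E.
Proof.
rewrite /mixture /msum/=.
under eq_bigr do rewrite /mscale/= diracT mule1.
by rewrite sumEFin w1.
Qed.

HB.instance Definition _ := Measure_isProbability.Build _ _ _ mixture mixture_setT.

Definition mixture_prob : probability T R := mixture.

Lemma ge0_expect_mixture (f : T -> R) : measurable_fun setT f ->
  (forall y, 0 <= f y) -> \int[mixture_prob]_y f y = \sum_(i < n) w i * f (x i).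
Proof.
move=> mf f0; have mf' : measurable_fun setT (EFin \o f) by exact/measurable_EFinP.
rewrite /Rintegral (_ : (\int[_]_y _)%E = (\sum_(i < n) w i * f (x i))%:E)//.
rewrite ge0_integral_measure_sum//; last by move=> y _; rewrite lee_fin.
rewrite -sumEFin; apply: eq_bigr => i _.
rewrite ge0_integral_mscale//; last by move=> y _; rewrite lee_fin.
by rewrite integral_dirac// diracT mul1e.
Qed.

Lemma expect_mixture (f : T -> R) : bmeas f ->
  \int[mixture_prob]_y f y = \sum_(i < n) w i * f (x i).
Proof.
move=> bf; have [mf [B fB]] := bf.
(* Adding the bound [B] reduces to the nonnegative case. *)
have bfB := bmeasD bf (bmeas_cst T B).
have f0 y : 0 <= f y + B.
  by have := fB y; rewrite ler_norml -subr_ge0 opprK => /andP[].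
transitivity (\int[mixture_prob]_y (f y + B) - B).
  by rewrite (expectD _ bf (bmeas_cst T B)) expect_cst addrK.
rewrite ge0_expect_mixture//; last by case: bfB.
under eq_bigr do rewrite mulrDr.
by rewrite big_split/= -mulr_suml w1 mul1r addrK.
Qed.

Lemma mixture_eq0 (N : set T) : (forall i, 0 < w i -> ~ N (x i)) ->
  mixture N = 0%E.
Proof.
move=> wN; rewrite /mixture /msum/= big1// => i _.
rewrite /mscale/= diracE; have := w0 i; rewrite le_eqVlt => /predU1P[wi|wi].
  by rewrite -wi mul0e.
by rewrite memNset ?mule0//; exact: wN.
Qed.

End finite_mixture.

(** * Random prices in {L, H} *)

Section two_prices.
Context (R : realType) (L H : R) (r : R).

(** [two_prices] has to be a probability for every real [r]; outside [0, 1] the weight of [L]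
    defaults to 0. *)
Let clamp := if 0 <= r <= 1 then r else 0.

Let w (i : nat) : R := if i == 0%N then clamp else if i == 1%N then 1 - clamp else 0.

Let w0 i : 0 <= w i.
Proof.
have /andP[c0 c1] : 0 <= clamp <= 1.
  by rewrite /clamp; case: ifP => // _; rewrite lexx ler01.
by rewrite /w; case: ifP => // _; case: ifP => // _; rewrite subr_ge0.
Qed.

Let w1 : \sum_(i < 2) w i = 1.
Proof. by rewrite !big_ord_recl big_ord0 /w/= addr0 addrC subrK. Qed.

Definition two_prices : probability (measurableTypeR R) R :=
  @mixture_prob _ (measurableTypeR R) R 2 w
    (fun i => if i == 0%N then L else H) w0 w1.

Hypothesis r01 : 0 <= r <= 1.

Lemma expect_two_prices (f : measurableTypeR R -> R) : bmeas f ->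
  \int[two_prices]_p f p = r * f L + (1 - r) * f H.
Proof.
move=> bf; rewrite /two_prices expect_mixture// !big_ord_recl big_ord0 /w/= addr0.
by rewrite /clamp r01.
Qed.

Lemma two_prices_ae (A : R -> Prop) : (0 < r -> A L) -> (r < 1 -> A H) ->
  {ae two_prices, forall p, A p}.
Proof.
move=> AL AH.
exists (~` ((if 0 < r then [set L] else set0) `|`
           (if r < 1 then [set H] else set0) : set (measurableTypeR R))).
split.
- by apply: measurableC; apply: measurableU; case: ifP.
- apply: mixture_eq0; rewrite /w /clamp r01 => -[|[|i]]/=.
  + by move=> -> ; apply; left.
  + by rewrite subr_gt0 => ->; apply; right.
  + by rewrite ltxx.
- move=> p/=; apply: contra_not => -[].
  + by case: ifP => // rp ->; exact: AL.
  + by case: ifP => // rp ->; exact: AH.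
Qed.

End two_prices.

Section at_signal.
Variables (R : realType) (X : signal R -> Type) (I0 : signal R).
Variables (x0 : X I0) (dflt : forall I, X I).

(** An assessment must give prices and beliefs for all signals. Here one signal gets a prescribed
    value, transported along the equality of signals, and all others a default. *)
Definition at_signal (I : signal R) : X I :=
  match pselect (I = I0) with
  | left e => eq_rect_r X x0 e
  | right _ => dflt I
  end.

Lemma at_signalE : at_signal I0 = x0.
Proof.
rewrite /at_signal; case: pselect => // e.
by rewrite (Prop_irrelevance e erefl).
Qed.

End at_signal.

Section finite_hull.
Variables (R : realType) (L H : R) (F : probability (measurableTypeR R) R).

(* Entries [(w, (mu, lam))]: weight, basic posterior, tie-breaking rule. *)
Definition finite_hull (z : R^o * R^o * R^o) := exists s : seq (R * (R * R)),
  [/\ forall e, e \in s -> [/\ 0 <= e.1, 0 <= e.2.1 <= 1 & 0 <= e.2.2 <= 1],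
      \sum_(e <- s) e.1 = 1 &
      z = (\sum_(e <- s) e.1 * e.2.1,
           \sum_(e <- s) e.1 * U L H F e.2.2 e.2.1,
           \sum_(e <- s) e.1 * Pi L H F e.2.2 e.2.1)].

(** [finite_hull] contains the graph and is convex: concatenate the two lists with weights rescaled
    by l and 1 - l. *)
Lemma convex_hull_finite z : convex_hull (graph L H F) z -> finite_hull z.
Proof.
apply; split=> [x y l /set_mem[s [s0 s1 ->]] /set_mem[s' [s'0 s'1 ->]]|_ [mu [lam [u01 l01 ->]]]].
  apply/mem_set.
  have l0 : 0 <= l%:num by [].
  have l1 : 0 <= 1 - l%:num by rewrite subr_ge0.
  exists ([seq (l%:num * e.1, e.2) | e <- s] ++ [seq ((1 - l%:num) * e.1, e.2) | e <- s']).
  split.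
  - move=> e; rewrite mem_cat => /orP[] /mapP[e' /[dup] es] .
      by move=> /s0[? ? ?] ->; split => //=; rewrite mulr_ge0.
    by move=> /s'0[? ? ?] ->; split => //=; rewrite mulr_ge0.
  - by rewrite big_cat !big_map/= -!mulr_sumr s1 s'1 !mulr1 addrC subrK.
  - have E (g : R * R -> R) : \sum_(e <- [seq (l%:num * e.1, e.2) | e <- s] ++
        [seq ((1 - l%:num) * e.1, e.2) | e <- s']) e.1 * g e.2 =
        l%:num * (\sum_(e <- s) e.1 * g e.2) + (1 - l%:num) * (\sum_(e <- s') e.1 * g e.2).
      rewrite big_cat !big_map/= !mulr_sumr.
      by congr (_ + _); apply: eq_bigr => e _; rewrite mulrA.
    by rewrite (E fst) (E (fun e => U L H F e.2 e.1)) (E (fun e => Pi L H F e.2 e.1)).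
exists [:: (1, (mu, lam))]; split.
- by move=> e; rewrite inE => /eqP ->; rewrite /= ler01.
- by rewrite big_seq1.
- by rewrite !big_seq1 !mul1r.
Qed.

End finite_hull.

(** * The hull is implementable *)

Section hull_game.
Variables (R : realType) (L H : R) (F : probability (measurableTypeR R) R).
Hypotheses (hL : 0 < L) (hLH : L < H) (hmu0 : 0 < prior_mean F < 1).
Variable Theta : set (measurableTypeR R).
Hypotheses (mTheta : measurable Theta) (Theta01 : Theta `<=` `[0, 1]%classic).
Hypothesis FTheta : F Theta = 1%:E.
Local Notation m := (prior_mean F).
Let m0 : 0 < m. Proof. by case/andP: hmu0. Qed.
Let m1 : 0 < 1 - m. Proof. by rewrite subr_gt0; case/andP: hmu0. Qed.
Let H0 : 0 < H. Proof. exact: lt_trans hLH. Qed.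
Let HL : 0 < H - L. Proof. by rewrite subr_gt0. Qed.
Let T01 x : Theta x -> 0 <= x <= 1.
Proof. by move=> /Theta01; rewrite /= in_itv. Qed.

Variables (n : nat) (wt mu lam : nat -> R).
Hypotheses (wt0 : forall i, 0 <= wt i) (mu01 : forall i, 0 <= mu i <= 1)
  (lam01 : forall i, 0 <= lam i <= 1).
Hypotheses (wt1 : \sum_(i < n) wt i = 1) (wtm : \sum_(i < n) wt i * mu i = m).

(** Probability of realization [i] given [v], by Bayes' rule from its total weight [wt i] and its
    basic posterior [mu i]. Both laws have mass one because the posteriors average to [m]. *)
Let wv (v : bool) i := if v then wt i * mu i / m else wt i * (1 - mu i) / (1 - m).

Let wv0 v i : 0 <= wv v i.
Proof.
have /andP[u0 u1] := mu01 i.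
by rewrite /wv; case: v; rewrite !mulr_ge0 ?subr_ge0// invr_ge0 ltW.
Qed.

Let wv1 v : \sum_(i < n) wv v i = 1.
Proof.
rewrite /wv; case: v; rewrite -mulr_suml; first by rewrite wtm divff// lt0r_neq0.
under eq_bigr do rewrite mulrBr mulr1.
by rewrite sumrB wt1 wtm divff// lt0r_neq0.
Qed.

Let law v : probability nat R := mixture_prob id (wv0 v) (wv1 v).

Let I0 : signal R := Signal law.

Let mnat d' (T : measurableType d') (f : nat -> T) : measurable_fun setT f.
Proof. by []. Qed.

Let bnat (f : nat -> R) : (forall i, 0 <= f i <= 1) -> bmeas f.
Proof. by move=> f01; apply: bmeas_le f01; exact: mnat. Qed.

Let r th i := low_share (threshold L H F (mu i)) (lam i) th.

Let r01 th i : 0 <= r th i <= 1.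
Proof.
rewrite /r /low_share; case: ifP => _; first by rewrite ler01 lexx.
by case: ifP => // _; rewrite lexx ler01.
Qed.

Let kern th : R.-pker nat ~> measurableTypeR R :=
  kprobability (P := fun i => two_prices L H (r th i) : pprobability (measurableTypeR R) R)
    (@mnat _ _ _).

Let dflt (I : signal R) : R.-pker sig_space I ~> measurableTypeR R :=
  kprobability (P := fun _ => two_prices L H 0 : pprobability (measurableTypeR R) R)
    (measurable_cst _).

(** A type with zero density never observes realization [i]; the belief [L / H] makes both prices
    optimal there, so whatever [low_share] prescribes is rational. *)
Let q th i : R := if type_density F (mu i) th == 0 then L / H else t F (mu i) th.

Let a : assessment R := @Assessment R
  (fun _ _ => I0)
  (fun th => @at_signal R (fun I => R.-pker sig_space I ~> measurableTypeR R) I0 (kern th) dflt)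
  (fun v p => (p <= val_of L H v)%R%:R)
  (fun th => @at_signal R (fun I => sig_space I -> R) I0 (q th) (fun _ _ => 0)).

Let M : menu R := fun I => I = I0.

Let priceE th : price a th I0 = kern th.
Proof. exact: at_signalE. Qed.

Let beliefE th : belief a th (I := I0) = q th.
Proof. exact: at_signalE. Qed.

Let q_dens th i : 0 <= th <= 1 ->
  q th i * type_density F (mu i) th = high_weight F (mu i) th.
Proof.
move=> th01; rewrite /q; case: eqVneq => [d0|_]; last exact: t_density.
have /andP[h0 hd] := high_weight_le hmu0 (mu01 i) th01.
by rewrite d0 mulr0; apply/eqP; rewrite eq_sym eq_le h0 andbT -d0.
Qed.

Let q01 th i : 0 <= th <= 1 -> 0 <= q th i <= 1.
Proof.
move=> th01; have /andP[h0 hd] := high_weight_le hmu0 (mu01 i) th01.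
have e := q_dens i th01; rewrite /q in e *; case: eqVneq e => [d0 _|dn e].
  by rewrite divr_ge0 ?(ltW hL) ?(ltW H0)// ler_pdivrMr// mul1r ltW.
have d0 : 0 < type_density F (mu i) th by rewrite lt_neqAle eq_sym dn (le_trans h0).
by rewrite -(pmulr_lge0 _ d0) -[t _ _ _ <= 1](ler_pM2r d0) mul1r e h0.
Qed.

Let buyerP : buyer_rational L H a.
Proof.
split=> [v|v p|v p b /andP[b0 b1]].
- have [//] : bmeas (buy a v : measurableTypeR R -> R).
  by apply: bmeas_bool; exact: measurable_fun_ler.
- by rewrite /=; case: (p <= val_of L H v); rewrite ?lexx ?ler01.
- rewrite /buyer_gain/=; case: (leP p (val_of L H v)) => [pv|vp].
    by rewrite mul1r ler_piMl// subr_ge0.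
  by rewrite mul0r mulr_ge0_le0// subr_le0 ltW.
Qed.

Let bayesP : bayes_consistent Theta M a.
Proof.
move=> th _ Tth ->; have th01 := T01 Tth; rewrite beliefE.
split=> [|i|A mA]; [exact: mnat|exact: q01|].
have bA : bmeas (fun i : nat => (i \in A)%:R : R).
  by apply: bnat => i; case: (_ \in _); rewrite ?lexx ?ler01.
have bq : bmeas (q th) by apply: bnat => i; exact: q01.
have AE v : \int[sig_law I0 v]_(s in A) q th s = \sum_(i < n) wv v i * (q th i * (val i \in A)%:R).
  transitivity (\int[law v]_s (q th s * (s \in A)%:R)).
    rewrite Rintegral_mkcond; apply: eq_Rintegral => s _; rewrite patchE.
    by case: (_ \in _); rewrite ?mulr1 ?mulr0.
  by rewrite /law (expect_mixture _ _ _ (bmeasM bq bA)).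
have -> : fine (sig_law I0 true A) = \sum_(i < n) wv true i * (val i \in A)%:R.
  rewrite -(expect_indic (law true) mA) -(expect_mixture id (wv0 true) (wv1 true) bA).
  by apply: eq_Rintegral => s _; rewrite indicE.
rewrite !AE !mulr_sumr -big_split/=; apply: eq_bigr => i _.
have := q_dens i th01; rewrite /type_density /high_weight /wv => e.
transitivity (wt i * (val i \in A)%:R * (th * mu i / m)); first by ring.
by rewrite -e; ring.
Qed.

Let revenue_L x : revenue a x L = L.
Proof.
rewrite /revenue /seller_gain/= lexx (ltW hLH) !mul1r.
by rewrite -mulrDl addrC subrK mul1r.
Qed.

Let revenue_H x : revenue a x H = x * H.
Proof.
by rewrite /revenue /seller_gain/= lexx leNgt hLH/= mul1r mul0r mulr0 addr0.
Qed.

Let revenue_le x p : 0 <= x <= 1 -> revenue a x p <= L \/ revenue a x p <= x * H.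
Proof.
move=> /andP[x0 x1]; rewrite /revenue /seller_gain/=.
have [pL|Lp] := leP p L.
  rewrite (le_trans pL (ltW hLH)) !mul1r; left.
  by rewrite -mulrDl addrC subrK mul1r.
have [pH|Hp] := leP p H; last by left; rewrite !mul0r !mulr0 addr0 ltW.
by right; rewrite mul1r mul0r mulr0 addr0 ler_wpM2l.
Qed.

Let pricingP : pricing_rational Theta M a.
Proof.
move=> th I s Tth MI; move: s; rewrite MI => i.
have th01 := T01 Tth; rewrite beliefE priceE.
have e := q_dens i th01; have x01 := q01 i th01.
have d0 := type_density_ge0 hmu0 (mu01 i) th01.
have /andP[h0 hd] := high_weight_le hmu0 (mu01 i) th01.
(* Dividing by the density gives comparisons of [q th i * H] with [L]; at zero density these two are
   equal by the default in [q]. *)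
have gap (b : bool) : (if b then H * high_weight F (mu i) th <= L * type_density F (mu i) th
    else L * type_density F (mu i) th <= H * high_weight F (mu i) th) ->
    if b then q th i * H <= L else L <= q th i * H.
  have [dE|dn] := eqVneq (type_density F (mu i) th) 0.
    by move=> _; rewrite /q dE eqxx divfK ?lt0r_neq0//; case: b.
  have dp : 0 < type_density F (mu i) th by rewrite lt_neqAle eq_sym dn.
  have -> : H * high_weight F (mu i) th = q th i * H * type_density F (mu i) th.
    by rewrite -e; ring.
  by case: b; rewrite ler_pM2r.
have cmp := price_gap_lt hL hLH hmu0 th (mu01 i).
have ceq := price_gap_eq hL hLH hmu0 (mu01 i) (theta := th).
apply: (@two_prices_ae R L H (r th i) (r01 th i)
  (fun p => forall p', revenue a (q th i) p' <= revenue a (q th i) p)).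
- rewrite /r /low_share => rp p'; rewrite revenue_L//.
  have qL : q th i * H <= L.
    apply: (gap true); move: rp; case: ifPn => [lt _|_].
      by rewrite ltW// cmp.
    by case: eqVneq => [/ceq ->|_]; rewrite ?ltxx.
  by case: (revenue_le p' x01) => // /le_trans; exact.
- rewrite /r /low_share => rp p'; rewrite revenue_H.
  have qL : L <= q th i * H.
    apply: (gap false); move: rp; case: ifPn => [_|nlt _]; first by rewrite ltxx.
    by rewrite leNgt cmp.
  by case: (revenue_le p' x01) => // /le_trans; exact.
Qed.

Let lowE th v : low_given L a th I0 v = \sum_(i < n) wv v i * r th i.
Proof.
rewrite /low_given -(expect_mixture id (wv0 v) (wv1 v) (bnat (r01 th))).
apply: eq_Rintegral => i _; rewrite /low_prob /kernel_prob priceE.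
have bL : bmeas (fun p : measurableTypeR R => ((p : R) == L)%:R : R).
  by apply: bmeas_bool; exact: measurable_fun_eqr.
transitivity (\int[two_prices L H (r th i)]_p ((p : R) == L)%:R) => //.
rewrite (expect_two_prices L H (r01 th i) bL) eqxx gt_eqF//.
by rewrite mulr1 mulr0 addr0.
Qed.

Let profit th := \sum_(i < n) wt i * (r th i * (L * type_density F (mu i) (clip th))
  + (1 - r th i) * (H * high_weight F (mu i) (clip th))).

Let surplus th := \sum_(i < n) wt i * (r th i * ((H - L) * high_weight F (mu i) (clip th))).

Let sellerE th : Theta th -> interim a (seller_gain a) th I0 = profit th.
Proof.
move=> Tth; have th01 := T01 Tth.
rewrite (interim_seller hL hLH buyerP bayesP pricingP Tth (erefl : M I0)).
rewrite !lowE /rule_profit/= /profit clip_id//.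
rewrite (_ : H - _ = \sum_(i < n) wv true i * (H - (H - L) * r th i)); last first.
  transitivity (\sum_(i < n) (H * wv true i - (H - L) * (wv true i * r th i))).
    by rewrite sumrB -!mulr_sumr wv1 mulr1.
  by apply: eq_bigr => i _; ring.
rewrite !mulr_sumr -big_split/=; apply: eq_bigr => i _.
by rewrite /wv /type_density /high_weight; ring.
Qed.

Let buyerE th : Theta th -> interim a (buyer_gain L H a) th I0 = surplus th.
Proof.
move=> Tth; have th01 := T01 Tth.
rewrite (interim_buyer hL hLH buyerP bayesP pricingP Tth (erefl : M I0)).
rewrite !lowE /surplus clip_id// !mulr_sumr; apply: eq_bigr => i _.
by rewrite /wv /high_weight; ring.
Qed.

Let br i : bmeas (fun x : measurableTypeR R => r x i).
Proof. exact: bmeas_low_share. Qed.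

Let bhigh k i : bmeas (fun x : measurableTypeR R => k * high_weight F (mu i) (clip x)).
Proof. by apply: bmeasM; [exact: bmeas_cst|exact: bmeas_high_weight]. Qed.

Let bprofit1 i : bmeas (fun x : measurableTypeR R =>
  r x i * (L * type_density F (mu i) (clip x))
  + (1 - r x i) * (H * high_weight F (mu i) (clip x))).
Proof.
apply: bmeasD; apply: bmeasM => //.
  by apply: bmeasM; [exact: bmeas_cst|exact: bmeas_type_density].
exact: bmeasB (bmeas_cst _ _) (br i).
Qed.

Let bsurplus1 i : bmeas (fun x : measurableTypeR R =>
  r x i * ((H - L) * high_weight F (mu i) (clip x))).
Proof. exact: bmeasM. Qed.

Let bprofit : bmeas (profit : measurableTypeR R -> R).
Proof. by apply: bmeas_sum => i; apply: bmeasM => //; exact: bmeas_cst. Qed.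

Let bsurplus : bmeas (surplus : measurableTypeR R -> R).
Proof. by apply: bmeas_sum => i; apply: bmeasM => //; exact: bmeas_cst. Qed.

Let choice_measP g (f : measurableTypeR R -> R) : bmeas f ->
  (forall th, Theta th -> interim a g th I0 = f th) ->
  measurable_fun (Theta `*` (`[0, 1] : set (measurableTypeR R)))
    (fun x : measurableTypeR R * measurableTypeR R =>
       interim a g x.1 (Defs.choice a x.1 x.2)).
Proof.
move=> [mf _] gf; apply: (@eq_measurable_fun _ _ _ _ _ (fun x => f x.1)).
  by move=> x /set_mem[Tx _]; rewrite gf.
by apply: measurable_funTS; apply: (measurableT_comp mf); exact: measurable_fst.
Qed.

Let equil : equilibrium L H Theta M a.
Proof.
split=> // [th w Tth w01|g [->|->]].
- by split=> // I ->.
- exact: choice_measP bprofit sellerE.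
- exact: choice_measP bsurplus buyerE.
Qed.

Let ex_anteE g (f : measurableTypeR R -> R) : bmeas f ->
  (forall th, Theta th -> interim a g th I0 = f th) ->
  ex_ante Theta F a g = \int[F]_x f x.
Proof.
move=> bf gf; rewrite /ex_ante Rintegral_mkcond.
have bfT : bmeas (fun x : measurableTypeR R => (x \in Theta)%:R * f x).
  by apply: bmeasM => //; exact: bmeas_mem.
transitivity (\int[F]_x ((x \in Theta)%:R * f x)); last first.
  apply: eq_expect_ae => //.
  by apply: filterS (ae_Theta mTheta FTheta) => x Tx; rewrite mem_set// mul1r.
apply: eq_Rintegral => x _; rewrite patchE.
case: ifPn => [/set_mem Tx|_]; last by rewrite mul0r.
rewrite mul1r -(gf _ Tx) Rintegral_mkcond -[RHS](expect_cst (uniform_prob (@ltr01 R))).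
have b1 : bmeas (fun w : measurableTypeR R => (w \in `[0, 1]%classic)%:R * interim a g x I0).
  by apply: bmeasM; [apply: bmeas_mem; exact: measurable_itv|exact: bmeas_cst].
rewrite (_ : (fun _ => _) \_ _ = fun w : measurableTypeR R =>
    (w \in `[0, 1]%classic)%:R * interim a g x I0); last first.
  by apply/funext => w; rewrite patchE; case: ifP; rewrite ?mul1r ?mul0r.
apply: eq_expect_ae => //; first exact: bmeas_cst.
apply: (ae_sub (ae_uniform ltr01)) => w /andP[w0 w1].
by rewrite mem_set ?mul1r//= in_itv/= (ltW w0).
Qed.

Lemma implementable_finite : implementable L H Theta F
  (\sum_(i < n) wt i * U L H F (lam i) (mu i),
   \sum_(i < n) wt i * Pi L H F (lam i) (mu i)).
Proof.
exists M, a; split; first exact: equil.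
rewrite (ex_anteE bsurplus buyerE) (ex_anteE bprofit sellerE).
congr (_, _).
- rewrite /surplus expect_sum; last by move=> i; apply: bmeasM => //; exact: bmeas_cst.
  apply: eq_bigr => i _; rewrite expectZl//.
  by rewrite (U_expect _ _ hmu0 mTheta Theta01 FTheta).
- rewrite /profit expect_sum; last by move=> i; apply: bmeasM => //; exact: bmeas_cst.
  apply: eq_bigr => i _; rewrite expectZl//.
  by rewrite (Pi_expect _ _ hmu0 mTheta Theta01 FTheta).
Qed.

End hull_game.

(** * The two inclusions *)

Theorem proposition3 (R : realType) (L H : R)
    (Theta : set (measurableTypeR R)) (F : probability (measurableTypeR R) R)
    (hL : 0 < L) (hLH : L < H)
    (mTheta : measurable Theta) (Theta01 : Theta `<=` `[0, 1]%classic)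
    (FTheta : F Theta = 1%:E)
    (hmu0 : 0 < prior_mean F < 1) :
  implementable L H Theta F = hull_section L H F.
Proof.
apply/seteqP; split=> [_ [M [a [equilP ->]]]|[x y] /convex_hull_finite].
  exact: (equilibrium_hull hL hLH mTheta Theta01 FTheta hmu0 equilP).
move=> [s [s0 s1 [sm -> ->]]].
(* The default entry (0, (0, 0)) meets the bounds, which [implementable_finite] requires at every
   index in [nat]. *)
pose e i := nth (0, (0, 0)) s i.
have e0 i : [/\ 0 <= (e i).1, 0 <= (e i).2.1 <= 1 & 0 <= (e i).2.2 <= 1].
  rewrite /e; have [|/(nth_default _) ->] := ltnP i (size s).
    by move=> /(mem_nth (0, (0, 0)))/s0.
  by rewrite /= lexx ler01.
have sE (g : R * (R * R) -> R) : \sum_(z <- s) g z = \sum_(i < size s) g (e i).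
  by rewrite (big_nth (0, (0, 0))) big_mkord.
rewrite !sE; apply: (implementable_finite hL hLH hmu0 mTheta Theta01 FTheta
  (wt := fun i => (e i).1) (mu := fun i => (e i).2.1) (lam := fun i => (e i).2.2)).
- by move=> i; case: (e0 i).
- by move=> i; case: (e0 i).
- by move=> i; case: (e0 i).
- by rewrite -sE.
- by rewrite -(sE (fun z => z.1 * z.2.1)) sm.
Qed.
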